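(* Let $\Gamma$ be a connected, compact metric graph. For all $k \geq 2$ there exists a $k$-partition $\mathcal{P}_k^C$ of $\Gamma$ such that $$h_k(\Gamma) = \Lambda^C(\mathcal{P}_k^C),$$ i.e. the infimum defining the $k$-th Cheeger constant $h_k(\Gamma)$ is attained.
   Context: **Metric graphs.** $\Gamma=(\mathcal V,\mathcal E)$ is a compact, connected metric graph with finite vertex set $\mathcal V(\Gamma)$ and finite edge set $\mathcal E(\Gamma)$; each edge is identified with a compact interval of finite positive length; multiple parallel edges and loops are allowed; $\Gamma$ is regarded as a compact metric space with the path metric. Any point of $\Gamma$ may be regarded as a (dummy, degree-two) vertex. $\deg_\Gamma(v)$ is the number of edge ends at $v$ (loops counted twice). **Subgraphs and descendants.** A subgraph $\Omega$ of $\Gamma$ is a closed subset of $\Gamma$ consisting of finitely many closed (sub)intervals of edges, together with a connectivity at its boundary points which may differ from that of $\Gamma$: at a boundary point $v$ the subgraph may be cut, i.e. $v$ is replaced by $m\ge 1$ points $v_1,\dots,v_m$ of $\Omega$, called the descendants of $v$ in $\Omega$, with each edge end of $\Omega$ at $v$ attached to exactly one $v_i$ (each $v_i$ receiving at least one). The case $m=1$ means the connectivity is unchanged. Boundary points are the points of the topological boundary of $\Omega$ as a subset of $\Gamma$, together with any points at which $\Omega$ is cut ($m\geq 2$). At all other points $\Omega$ has the connectivity of $\Gamma$. Thus $\Omega$ is itself a metric graph, and connectedness of $\Omega$ is meant with respect to this graph structure. $\partial\Omega$ denotes the set of all descendants in $\Omega$ of the boundary points, and $|\Omega|$ is the total length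 of $\Omega$. **Size of the boundary.** For a descendant $v_i\in\partial\Omega$ of $v\in\Gamma$, $\deg_\Omega(v_i)$ is the number of connected components of $B_\varepsilon(v_i)\setminus\{v_i\}$ for $\varepsilon>0$ small, where $B_\varepsilon(v_i)$ is the open ball in $\Omega$. The effective degree is $$\operatorname{eff\,deg}_\Omega(v_i) := \min\{\deg_\Omega(v_i),\ \deg_\Gamma(v)-\deg_\Omega(v_i)\},$$ and $|\partial\Omega| := \sum_{v_i\in\partial\Omega}\operatorname{eff\,deg}_\Omega(v_i)$. **Partitions.** A $k$-partition of $\Gamma$ is a collection $\mathcal P=(\Omega_1,\dots,\Omega_k)$ of $k$ connected subgraphs of $\Gamma$ with nonempty interiors such that for all $i\ne j$ the intersection $\Omega_i\cap\Omega_j$ (as subsets of $\Gamma$) is a finite set consisting of common boundary points of $\Omega_i$ and $\Omega_j$. It is not required that $\bigcup_i\Omega_i=\Gamma$. **Cheeger functional and constant.** For a partition $\mathcal P=(\Omega_1,\dots,\Omega_k)$, $$\Lambda^C(\mathcal P)=\max_{i=1,\dots,k}\frac{|\partial\Omega_i|}{|\Omega_i|},\qquad h_k(\Gamma)=\inf\{\Lambda^C(\mathcal P_k):\mathcal P_k \text{ is a $k$-partition of }\Gamma\}.$$ *)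

(* Defs.v *)
From HB Require Import structures.
From mathcomp Require Import all_boot all_order all_algebra.
From mathcomp Require Import all_classical all_reals all_analysis.

Set Implicit Arguments.
Unset Strict Implicit.
Unset Printing Implicit Defensive.

Import Order.TTheory GRing.Theory Num.Theory.
Import numFieldTopology.Exports.

Local Open Scope classical_set_scope.
Local Open Scope ring_scope.

(** * Metric graphs *)

(* [e : edge] is identified with the interval [0, len e], with [0] glued to
   [src e] and [len e] glued to [tgt e]; loops and parallel edges are allowed. *)
Record mgraph (R : realType) := MGraph {
  vertex : finType;
  edge : finType;
  src : edge -> vertex;
  tgt : edge -> vertex;
  len : edge -> R;
  len_gt0 : forall e, 0 < len e }.

(* The points of the graph: its vertices, and the pairs [(e, t)] with
   [0 < t < len e]. *)
Definition mpoint (R : realType) (G : mgraph R) : Type :=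
  (vertex G + {e : edge G & {t : R | 0 < t < len e}})%type.

HB.instance Definition _ (R : realType) (G : mgraph R) :=
  Choice.copy (mpoint G)
    (vertex G + {e : edge G & {t : R | 0 < t < len e}})%type.

(* The image in the graph of the point at coordinate [t] of [0, len e]
   (clamped when [t] is outside this interval). *)
Definition edge_pt (R : realType) (G : mgraph R) (e : edge G) (t : R) :
    mpoint G :=
  if t <= 0 then inl (src e)
  else if insub t is Some u then
    inr (existT (fun e : edge G => {t : R | 0 < t < len e}) e u)
  else inl (tgt e).

(* [path_len p q l]: [q] can be reached from [p] by a path of length [l] made
   of finitely many segments, each of them inside a closed edge. *)
Inductive path_len (R : realType) (G : mgraph R) :
    mpoint G -> mpoint G -> R -> Prop :=
| path_nil p : path_len p p 0
| path_step e s t q l :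
    0 <= s <= len e -> 0 <= t <= len e ->
    path_len (edge_pt e t) q l ->
    path_len (edge_pt e s) q (`|s - t| + l).

(* The path metric, equal to [+oo] between distinct connected components. *)
Definition pdist (R : realType) (G : mgraph R) (p q : mpoint G) : \bar R :=
  ereal_inf [set l%:E | l in path_len p q].

Definition pball (R : realType) (G : mgraph R) (p : mpoint G) (r : R) :
    set (mpoint G) :=
  [set q | (pdist p q < r%:E)%E].

Section path_metric.
Context {R : realType} {G : mgraph R}.
Implicit Types p q r : mpoint G.

Lemma path_len_trans p q r l m :
  path_len p q l -> path_len q r m -> path_len p r (l + m).
Proof.
move=> pq; elim: pq r m => {p q l} [p r m|e s t q l hs ht _ IH r m /IH qr].
  by rewrite add0r.
by rewrite -addrA; apply: path_step.
Qed.

Lemma path_len_sym p q l : path_len p q l -> path_len q p l.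
Proof.
elim=> {p q l} [p|e s t q l hs ht _ IH]; first exact: path_nil.
rewrite addrC; apply: path_len_trans IH _.
by rewrite distrC -[X in path_len _ _ X]addr0; apply: path_step => //;
  apply: path_nil.
Qed.

Lemma pballE p (e : R) q :
  pball p e q <-> exists2 l, path_len p q l & l < e.
Proof.
split=> [/ereal_inf_lt[_ [l pql <-]]|[l pql le]].
  by rewrite lte_fin; exists l.
rewrite /pball /= /pdist; apply: (@le_lt_trans _ _ l%:E); last by rewrite lte_fin.
by apply: ereal_inf_lbound; exists l.
Qed.

Lemma pball_center p (e : R) : 0 < e -> pball p e p.
Proof. by move=> e0; apply/pballE; exists 0 => //; apply: path_nil. Qed.

Lemma pball_sym p q (e : R) : pball p e q -> pball q e p.
Proof.
by move=> /pballE[l pq le]; apply/pballE; exists l => //; apply: path_len_sym.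
Qed.

Lemma pball_triangle p q r (e1 e2 : R) :
  pball p e1 q -> pball q e2 r -> pball p (e1 + e2) r.
Proof.
move=> /pballE[l pq le] /pballE[m qr me]; apply/pballE; exists (l + m).
  exact: path_len_trans pq qr.
exact: ltrD.
Qed.

End path_metric.

(* The topology of a metric graph is the one of its path metric. *)
HB.instance Definition _ (R : realType) (G : mgraph R) :=
  hasNbhs.Build (mpoint G) (nbhs_ (entourage_ (@pball R G))).

HB.instance Definition _ (R : realType) (G : mgraph R) :=
  @Nbhs_isPseudoMetric.Build R (mpoint G) (entourage_ (@pball R G)) erefl
    (@pball R G) pball_center pball_sym pball_triangle erefl.

Definition mgraph_connected (R : realType) (G : mgraph R) : Prop :=
  connected [set: mpoint G].

(* The number of edge ends at a point, a loop being counted twice; a point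
   inside an edge is a dummy vertex of degree two. *)
Definition edge_ends (R : realType) (G : mgraph R) (p : mpoint G) : nat :=
  match p with
  | inl v => #|[set e : edge G | src e == v]%SET| +
             #|[set e : edge G | tgt e == v]%SET|
  | inr _ => 2
  end.

Definition components (T : topologicalType) (A : set T) : set (set T) :=
  [set connected_component A x | x in A].

(* The number of connected components of the punctured ball of radius [r] at
   [q], for all small [r > 0]. *)
Definition ball_degree (R : realType) (G : mgraph R) (q : mpoint G) : nat :=
  xget 0%N [set n : nat | \forall r \near (0 : R)^'+,
    (components (ball q r `\ q) #= `I_n)%card].

(** * Subgraphs *)

(* A subgraph of [G] is a metric graph together with a map to [G] identifying
   each of its edges [f] with the closed interval
   [start f, start f + len f] of the edge [carrier f] of [G], and sending each
   vertex to a point of [G].  The vertices sent to [p] are the descendants of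
   [p]; they may share the edge ends at [p] in any way. *)
Record subgraph (R : realType) (G : mgraph R) := Subgraph {
  sub_graph :> mgraph R;
  carrier : edge sub_graph -> edge G;
  start : edge sub_graph -> R;
  place : vertex sub_graph -> mpoint G;
  start_ge0 : forall f, 0 <= start f;
  stop_le : forall f, start f + len f <= len (carrier f);
  place_src : forall f, place (src f) = edge_pt (carrier f) (start f);
  place_tgt : forall f, place (tgt f) = edge_pt (carrier f) (start f + len f);
  edges_disjoint : forall f g, f <> g -> carrier f = carrier g ->
    start f + len f <= start g \/ start g + len g <= start f;
  vertex_end : forall v : vertex sub_graph,
    exists f : edge sub_graph, src f = v \/ tgt f = v }.

Section subgraph_defs.
Context {R : realType} {G : mgraph R}.
Implicit Types O : subgraph G.

(* The point of [G] of which a point of [O] is a descendant. *)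
Definition proj O (q : mpoint O) : mpoint G :=
  match q with
  | inl v => place v
  | inr (existT f u) => edge_pt (carrier f) (start f + val u)
  end.

Definition sub_support O : set (mpoint G) := range (@proj O).

Definition topological_boundary (T : topologicalType) (A : set T) : set T :=
  closure A `\` interior A.

Definition cut_points O : set (mpoint G) :=
  [set p | exists q1 q2 : mpoint O,
    [/\ q1 <> q2, proj q1 = p & proj q2 = p]].

Definition boundary_points O : set (mpoint G) :=
  topological_boundary (sub_support O) `|` cut_points O.

Definition sub_boundary O : set (mpoint O) :=
  @proj O @^-1` boundary_points O.

(* The subtraction never truncates: the edge ends at [q] are among those at
   [proj q]. *)
Definition eff_deg O (q : mpoint O) : nat :=
  minn (ball_degree q) (edge_ends (proj q) - ball_degree q).

Definition boundary_size O : R :=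
  \sum_(q \in @sub_boundary O) ((eff_deg q)%:R : R).

Definition total_length O : R := \sum_(f : edge O) len f.

(** * Partitions and Cheeger constants *)

Definition is_partition (k : nat) (P : 'I_k -> subgraph G) : Prop :=
  [/\ forall i, mgraph_connected (P i),
      forall i, interior (sub_support (P i)) !=set0,
      forall i j, i <> j -> finite_set (sub_support (P i) `&` sub_support (P j)) &
      forall i j, i <> j ->
        sub_support (P i) `&` sub_support (P j) `<=`
        boundary_points (P i) `&` boundary_points (P j)].

(* The value [0] of an empty maximum is immaterial: the ratios are
   nonnegative. *)
Definition Lambda_C (k : nat) (P : 'I_k -> subgraph G) : R :=
  \big[Num.max/0]_(i < k) (boundary_size (P i) / total_length (P i)).

End subgraph_defs.

Definition cheeger (R : realType) (G : mgraph R) (k : nat) : R :=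
  inf [set x : R | exists P : 'I_k -> subgraph G,
    is_partition P /\ Lambda_C P = x].

(* Main.v *)
From mathcomp Require Import all_boot all_order all_algebra.
From mathcomp Require Import all_classical all_reals all_analysis.
From mathcomp Require Import lra zify.
Require Import Defs.

Set Implicit Arguments.
Unset Strict Implicit.
Unset Printing Implicit Defensive.

Import Order.TTheory GRing.Theory Num.Theory.
Import numFieldTopology.Exports.

Local Open Scope classical_set_scope.
Local Open Scope ring_scope.

(** Why the infimum is attained.  The pieces of a partition are first simplified
    without changing their lengths or increasing their boundaries: a vertex in
    the interior of an edge of the graph that joins two edges of a piece is a
    dummy vertex, and is removed ([exists_reduced]).  A connected piece without
    such vertices consists of full edges of the graph and of stubs, which have
    one end at a vertex of the graph (the anchored end) and the other one inside
    an edge (the floating end), or it is one segment with two floating ends.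
    Its combinatorial type, a skeleton, records everything except the positions
    of the ends of its edges, and there are only finitely many skeletons
    ([reduced_card_edge]).  The size of the boundary depends on the skeleton
    alone; the length is a continuous function of the positions, and the
    conditions that the positions have to satisfy are closed.

    So one takes a minimizing sequence of partitions, and an ultrafilter along
    which all the skeletons are constant and all the positions converge
    ([admissible_limit]).  The limit has the right ratios, but some of its edges
    may have shrunk to a point.  Two observations deal with these.

    A full edge cannot shrink, so what shrinks is a stub, unless the whole piece
    does.  Deleting a stub removes its floating end, which contributes 1 to the
    boundary, and lowers by 1 the degree of its anchored end, which changes the
    effective degree there by at most 1.  Hence the boundary does not grow
    ([realize_boundary]); the length does not change, and connectedness
    survives, because a stub leads nowhere.

    A whole piece cannot shrink: the inequality between boundary and length would
    leave it without boundary, hence without floating ends; then it would consist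
    of full edges, which do not shrink ([sk_length_gt0]).

    All of this is combinatorial.  The topology enters only through four
    translations: the degree at a vertex is its number of edge ends
    ([ball_degree_vertex]), the size of the boundary is a sum over all vertices
    ([boundary_sizeE]), connectedness is that of the underlying multigraph
    ([mgraph_connectedP]), and being a partition means that edges of different
    pieces do not overlap ([is_partitionP]). *)

(** * Coordinates on a metric graph *)

Section coordinates.
Context {R : realType} {G : mgraph R}.
Implicit Types (e : edge G) (v : vertex G) (p q : mpoint G) (s t r : R).

Lemma edge_pt_src e t : t <= 0 -> edge_pt e t = inl (src e).
Proof. by rewrite /edge_pt => ->. Qed.

Lemma edge_pt_tgt e t : len e <= t -> edge_pt e t = inl (tgt e).
Proof.
move=> et; rewrite /edge_pt leNgt (lt_le_trans (len_gt0 e) et) /=.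
by case: insubP => // u /andP[_]; rewrite ltNge et.
Qed.

Lemma edge_pt_inside e t (ht : 0 < t < len e) :
  edge_pt e t = inr (existT _ e (exist _ t ht)).
Proof.
by rewrite /edge_pt leNgt (andP ht).1 /= insubT.
Qed.

Lemma edge_pt_inr e t f u :
  edge_pt e t = inr (existT _ f u) -> [/\ f = e, val u = t & 0 < t < len e].
Proof.
have [ht|] := boolP (0 < t < len e).
  rewrite edge_pt_inside // => -[ef]; subst f => E.
  by rewrite -(@eq_from_Tagged _ (fun e : edge G => {t : R | 0 < t < len e}) _ _ _ E).
by rewrite negb_and -!leNgt => /orP[/edge_pt_src|/edge_pt_tgt] ->.
Qed.

Lemma edge_pt_inj e f s t : 0 < s < len e -> edge_pt e s = edge_pt f t ->
  f = e /\ t = s.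
Proof.
by move=> hs; rewrite edge_pt_inside => /esym /edge_pt_inr[] /= ef st _; split.
Qed.

Lemma edge_pt_inl e t v : 0 <= t <= len e -> edge_pt e t = inl v ->
  (t = 0 /\ v = src e) \/ (t = len e /\ v = tgt e).
Proof.
move=> /andP[t0 te]; have [t0'|t0'] := leP t 0.
  by rewrite edge_pt_src // => -[<-]; left; split => //; apply/eqP; rewrite eq_le t0 t0'.
have [te'|te'] := leP (len e) t.
  by rewrite edge_pt_tgt // => -[<-]; right; split => //; apply/eqP; rewrite eq_le te te'.
by rewrite edge_pt_inside ?t0'.
Qed.

Lemma mpointP p :
  (exists v, p = inl v) \/ (exists e t, 0 < t < len e /\ p = edge_pt e t).
Proof.
case: p => [v|[e [t ht]]]; first by left; exists v.
by right; exists e, t; rewrite edge_pt_inside.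
Qed.

Definition clamp e t := Num.min (len e) (Num.max 0 t).

Lemma clampP e t : 0 <= clamp e t <= len e.
Proof.
have := len_gt0 e; rewrite /clamp /Num.min /Num.max; case: ifP; case: ifP; lra.
Qed.

Lemma edge_pt_clamp e t : edge_pt e (clamp e t) = edge_pt e t.
Proof.
have e0 := len_gt0 e; have [t0|t0] := leP t 0.
  rewrite (edge_pt_src e t0) edge_pt_src // /clamp.
  by rewrite (max_idPl t0) ge_min lexx orbT.
have [te|te] := leP (len e) t.
  rewrite (edge_pt_tgt te) edge_pt_tgt // /clamp le_min lexx /=.
  by rewrite le_max te orbT.
by rewrite /clamp (max_idPr (ltW t0)) (min_idPr (ltW te)).
Qed.

Lemma clamp_dist e s t : `|clamp e s - clamp e t| <= `|s - t|.
Proof.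
have := len_gt0 e; rewrite /clamp /Num.min /Num.max.
by case: ifP; case: ifP; case: ifP; case: ifP; rewrite !ler_norml;
  have := ler_norm (s - t); have := ler_norm (t - s); rewrite (distrC t); lra.
Qed.

Lemma path_len_edge e s t : 0 <= s <= len e -> 0 <= t <= len e ->
  path_len (edge_pt e s) (edge_pt e t) `|s - t|.
Proof.
move=> hs ht; rewrite -[X in path_len _ _ X]addr0.
by apply: path_step => //; apply: path_nil.
Qed.

Lemma path_len_ge0 p q (l : R) : path_len p q l -> 0 <= l.
Proof. by elim=> // *; rewrite addr_ge0. Qed.

Lemma ball_edge_pt e s t r : `|s - t| < r ->
  ball (edge_pt e s) r (edge_pt e t).
Proof.
move=> st; apply/pballE; exists `|clamp e s - clamp e t|.
  by rewrite -(edge_pt_clamp e s) -(edge_pt_clamp e t); apply: path_len_edge; apply: clampP.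
exact: le_lt_trans (clamp_dist _ _ _) st.
Qed.

Lemma continuous_edge_pt e : continuous (edge_pt e : R -> mpoint G).
Proof.
move=> t A /nbhs_ballP[r /= r0 rA]; apply/nbhs_ballP; exists r => // s ts.
exact/rA/ball_edge_pt.
Qed.

(** An edge can only be left through its ends, so a path shorter than the
    distance to both of them stays in the edge. *)
Lemma path_len_inside p q (l : R) e t : path_len p q l -> p = edge_pt e t ->
  l < t -> l < len e - t -> exists2 s, q = edge_pt e s & `|t - s| <= l.
Proof.
move=> pq; elim: pq e t => {p q l} [p|f s s' q l hs hs' pq IH] e t.
  by move=> -> _ _; exists t; rewrite // subrr normr0.
have l0 := path_len_ge0 pq; have n0 : 0 <= `|s - s'| by [].
move=> /esym E lt1 lt2; have [|? ?] := edge_pt_inj _ E; first by apply/andP; split; lra.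
have n1 := ler_norm (s - s'); have n2 : s' - s <= `|s - s'| by rewrite distrC ler_norm.
subst f s; have [||s -> ts] := IH e s' erefl; try lra.
exists s => //; have -> : t - s = (t - s') + (s' - s) by lra.
by apply: (le_trans (ler_normD _ _)); lra.
Qed.

Lemma ball_inside e t r q : r <= t -> r <= len e - t ->
  ball (edge_pt e t) r q -> exists2 s, q = edge_pt e s & `|t - s| < r.
Proof.
move=> rt re /pballE[l pl lr].
have [||s -> ts] := path_len_inside pl erefl; try lra.
by exists s => //; lra.
Qed.

End coordinates.

(** * Degrees as numbers of edge ends *)

Lemma card_setII (T : finType) (F : {set T}) : ([set` F] #= `I_#|F|)%card.
Proof.
have -> : [set` F] = enum_val @` [set: 'I_#|F|].
  apply/seteqP; split=> [x /= xF|_ [i _ <-]]; last exact: enum_valP.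
  by exists (enum_rank_in xF x) => //; rewrite enum_rankK_in.
rewrite card_eq_sym; apply: card_eq_trans (card_II) _; rewrite card_eq_sym.
by apply: inj_card_eq; apply: in2W; exact: enum_val_inj.
Qed.

(** A connected subset of the union that meets one of the sets lies in it,
    because the others form an open set: so these sets are the components. *)
Lemma card_components (T : topologicalType) (I : finType) (F : {set I})
    (B : I -> set T) :
  (forall i, i \in F -> B i !=set0) -> (forall i, i \in F -> open (B i)) ->
  (forall i, i \in F -> connected (B i)) ->
  (forall i j x, i \in F -> j \in F -> B i x -> B j x -> i = j) ->
  (components (\bigcup_(i in [set` F]) B i) #= `I_#|F|)%card.
Proof.
move=> B0 Bo Bc Bd; set A := \bigcup_(i in _) _.
have cB i x : i \in F -> B i x -> connected_component A x = B i.
  move=> iF Bx; apply/seteqP; split; last first.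
    by apply: connected_component_max => // [y By|]; [exists i|apply: Bc].
  move=> y [C [Cx CA Cc] Cy]; suff CB : C `&` B i = C by move: Cy; rewrite -CB => -[].
  pose D := \bigcup_(j in [set` F :\ i]) B j.
  apply: Cc; first by exists x.
    by exists (B i) => //; apply: Bo.
  exists (~` D).
    apply: open_closedC; apply: bigcup_open => j /=; rewrite !inE => /andP[_].
    exact: Bo.
  apply/seteqP; split=> z [Cz Bz]; split => //.
    move=> [j /=]; rewrite !inE => /andP[ji jF] Bjz.
    by move: ji; rewrite (Bd _ _ _ jF iF Bjz Bz) eqxx.
  have [j jF Bj] := CA _ Cz; have [<- //|ji] := eqVneq j i.
  by case: Bz; exists j => //=; rewrite !inE ji.
have -> : components A = B @` [set` F].
  apply/seteqP; split=> [_ [x [i iF Bx] <-]|_ [i iF <-]].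
    by exists i => //; rewrite (cB i).
  have [x Bx] := B0 i iF; exists x; last exact: cB.
  by exists i.
apply: card_eq_trans (card_setII F); apply: inj_card_eq => i j.
rewrite !inE /= => iF jF Bij; have [x Bx] := B0 i iF.
by apply: (Bd i j x) => //; rewrite -Bij.
Qed.

Section degree.
Context {R : realType} {G : mgraph R}.
Implicit Types (e : edge G) (v : vertex G) (p q : mpoint G) (s t r : R).

Definition end_vertex (x : edge G * bool) : vertex G :=
  if x.2 then tgt x.1 else src x.1.

Lemma edge_endsE v : edge_ends (inl v : mpoint G) =
  #|[set x : edge G * bool | end_vertex x == v]%SET|.
Proof.
rewrite /edge_ends.
pose A := [set x : edge G * bool | (src x.1 == v) && ~~ x.2]%SET.
pose B := [set x : edge G * bool | (tgt x.1 == v) && x.2]%SET.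
have -> : [set x | end_vertex x == v]%SET = (A :|: B)%SET.
  by apply/setP => -[e []]; rewrite !inE /end_vertex /= ?andbT ?andbF ?orbF.
rewrite cardsU (_ : (A :&: B)%SET = finset.set0); last first.
  by apply/setP => -[e []]; rewrite !inE /= ?andbF.
rewrite cards0 subn0; congr addn.
  rewrite -(card_imset _ (f := fun e : edge G => (e, false))); last by move=> ? ? [].
  congr #|pred_of_set _|; apply/setP => -[e b]; rewrite inE /=.
  apply/imsetP/andP => [[f]|[ev]].
    by rewrite inE => fv [-> ->].
  by case: b => // _; exists e; rewrite ?inE.
rewrite -(card_imset _ (f := fun e : edge G => (e, true))); last by move=> ? ? [].
congr #|pred_of_set _|; apply/setP => -[e b]; rewrite inE /=.
apply/imsetP/andP => [[f]|[ev]].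
  by rewrite inE => fv [-> ->].
by case: b => // _; exists e; rewrite ?inE.
Qed.

(* The distance to [v], cut off at [r] for [r] at most the lengths of all edges:
   a function that is 1-Lipschitz along paths bounds the path metric below. *)
Let height v r p : R := match p with
  | inl w => if w == v then 0 else r
  | inr (existT e u) => Num.min r (Num.min (if src e == v then val u else r)
                                    (if tgt e == v then len e - val u else r))
  end.

Let height_edge v r e t : 0 <= t <= len e -> 0 <= r <= len e ->
  height v r (edge_pt e t) = Num.min r (Num.min (if src e == v then t else r)
                                    (if tgt e == v then len e - t else r)).
Proof.
move=> /andP[t0 te] /andP[r0 re]; have e0 := len_gt0 e.
have [t0'|t0'] := leP t 0.
  rewrite edge_pt_src //=; have -> : t = 0 by lra.
  by case: (src e == v); case: (tgt e == v); rewrite /Num.min; repeat case: ifP; lra.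
have [te'|te'] := leP (len e) t.
  rewrite edge_pt_tgt //=; have -> : t = len e by lra.
  by case: (src e == v); case: (tgt e == v); rewrite /Num.min; repeat case: ifP; lra.
have ht : 0 < t < len e by rewrite t0'.
by rewrite (edge_pt_inside ht).
Qed.

Let height_lip v r p q (l : R) : 0 <= r -> (forall e, r <= len e) ->
  path_len p q l -> height v r q <= height v r p + l.
Proof.
move=> r0 re; elim=> {p q l} [p|e s t q l hs ht _ IH]; first by rewrite addr0.
apply: (le_trans IH); rewrite addrA lerD2r !height_edge ?r0 ?re //.
have n1 := ler_norm (s - t); have n2 : t - s <= `|s - t| by rewrite distrC ler_norm.
have n0 : 0 <= `|s - t| by [].
by case: (src e == v); case: (tgt e == v); rewrite /Num.min; repeat case: ifP; lra.
Qed.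

Let branch_itv r (x : edge G * bool) : interval R :=
  if x.2 then `]len x.1 - r, len x.1[ else `]0, r[.

(* For small [r] the punctured ball at [v] is the disjoint union of one open
   branch for each edge end at [v]. *)
Let branch r (x : edge G * bool) : set (mpoint G) :=
  edge_pt x.1 @` [set` branch_itv r x].

Let branch_in r e b t : r <= len e / 2 ->
  t \in branch_itv r (e, b) -> 0 < t < len e.
Proof.
have := len_gt0 e; rewrite /branch_itv; case: b => /=; rewrite in_itv /= => e0 re /andP[];
  by move=> *; apply/andP; split; lra.
Qed.

Let star v r : 0 < r -> (forall e, r <= len e / 2) ->
  ball (inl v : mpoint G) r `\ (inl v : mpoint G) =
  \bigcup_(x in [set` [set x | end_vertex x == v]%SET]) branch r x.
Proof.
move=> r0 re; have e0 e := len_gt0 e; apply/seteqP; split=> q; last first.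
  move=> [[e b] /=]; rewrite inE => /eqP ev [t ht <-]; split; last first.
    by move=> /= E; have h := branch_in (re e) ht; move: E; rewrite edge_pt_inside.
  have := branch_in (re e) ht; case: b ev ht; rewrite /end_vertex /branch_itv /= in_itv /=.
    move=> <- ht /andP[_ te]; rewrite -(edge_pt_tgt (lexx (len e))).
    apply: ball_edge_pt; rewrite ger0_norm; lra.
  move=> <- /andP[t0 tr] _; rewrite -(edge_pt_src e (lexx 0)).
  by apply: ball_edge_pt; rewrite sub0r normrN ger0_norm; lra.
move=> [/pballE[l pl lr] /= qv].
have re' e : r <= len e by apply: (le_trans (re e)); have := e0 e; lra.
have := height_lip v (ltW r0) re' pl; rewrite /= eqxx add0r => hq.
have {hq} : height v r q < r by lra.
have [[w qw]|[e [t [ht qt]]]] := mpointP q.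
  by subst q => /=; case: eqP => [E|_]; [case: qv; rewrite E|rewrite ltxx].
have ht' : 0 <= t <= len e by lra.
rewrite qt height_edge ?re' ?(ltW r0)//.
rewrite !gt_min ltxx /= => /orP[].
  case: ifP => [sv tr|_]; last by rewrite ltxx.
  exists (e, false) => /=; first by rewrite inE.
  by exists t => //=; rewrite in_itv /=; lra.
case: ifP => [sv tr|_]; last by rewrite ltxx.
exists (e, true) => /=; first by rewrite inE.
by exists t => //=; rewrite in_itv /=; lra.
Qed.

Let card_star v r : 0 < r -> (forall e, r <= len e / 2) ->
  (components (ball (inl v : mpoint G) r `\ (inl v : mpoint G)) #=
   `I_(edge_ends (inl v : mpoint G)))%card.
Proof.
move=> r0 re; have e0 e := len_gt0 e; rewrite star // edge_endsE.
apply: card_components => [[e b] _|[e b] _|[e b] _|].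
- have := e0 e; have := re e; case: b => ? ?.
    by exists (edge_pt e (len e - r / 2)); exists (len e - r / 2) => //=;
      rewrite in_itv /=; apply/andP; split; lra.
  by exists (edge_pt e (r / 2)); exists (r / 2) => //=;
      rewrite in_itv /=; apply/andP; split; lra.
- rewrite openE => _ [t ht <-]; apply/nbhs_ballP => /=.
  have te := branch_in (re e) ht; move: (ht); have := re e; have := e0 e.
  case: b ht => ht ? ?; rewrite /= in_itv /= => /andP[t1 t2].
    exists (Num.min (t - (len e - r)) (len e - t)).
      by rewrite /= lt_min; apply/andP; split; lra.
    move=> q /ball_inside[| |s -> ]; rewrite ?ge_min ?lexx ?orbT //.
      by apply/orP; left; lra.
    rewrite lt_min => /andP[]; rewrite !ltr_norml => /andP[??] /andP[??].
    by exists s => //=; rewrite in_itv /=; apply/andP; split; lra.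
  exists (Num.min t (r - t)).
    by rewrite /= lt_min; apply/andP; split; lra.
  move=> q /ball_inside[| |s -> ]; rewrite ?ge_min ?lexx ?orbT //.
    by apply/orP; right; lra.
  rewrite lt_min => /andP[]; rewrite !ltr_norml => /andP[??] /andP[??].
  by exists s => //=; rewrite in_itv /=; apply/andP; split; lra.
- apply: connected_continuous_connected.
    by case: b; apply/connected_intervalP/interval_is_interval.
  by apply: continuous_subspaceT => t; apply: continuous_edge_pt.
- move=> [e b] [f c] p _ _ [t ht <-] [s hs] /esym E.
  have [fe st] := edge_pt_inj (branch_in (re e) ht) E; move: hs ht.
  rewrite /= in fe st *; subst f s; have := re e; have := e0 e.
  by rewrite /branch_itv; case: b {E}; case: c; rewrite //= !in_itv /=;
    move=> ? ? /andP[? ?] /andP[? ?]; exfalso; lra.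
Qed.

(** For small radii the punctured ball is a union of disjoint open intervals,
    one for each edge end; a loop has two ends, which give two intervals. *)
Lemma ball_degree_vertex v :
  ball_degree (inl v : mpoint G) = edge_ends (inl v : mpoint G).
Proof.
pose m : R := \big[Num.min/1]_(e : edge G) (len e / 2).
have m0 : 0 < m.
  by apply: lt_bigmin => // e _; rewrite divr_gt0 ?len_gt0.
have near_star : \forall r \near (0 : R)^'+,
    (components (ball (inl v : mpoint G) r `\ (inl v : mpoint G)) #=
     `I_(edge_ends (inl v : mpoint G)))%card.
  near=> r; apply: card_star => // e.
  apply: (@le_trans _ _ m); last exact: bigmin_le.
  by near: r; apply: nbhs_right_le.
apply: xget_unique => // n near_n.
have [r [r1 r2]] := filter_ex (filterI near_star near_n).
by apply/card_eq_II; rewrite card_eq_sym in r2; apply: card_eq_trans r2 r1.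
Unshelve. all: by end_near. Qed.

End degree.

(** * Connectedness *)

Section connectivity.
Context {R : realType} (G : mgraph R).

Lemma edge_connected (e : edge G) : connected (edge_pt e @` [set: R]).
Proof.
apply: connected_continuous_connected; first exact/connected_intervalP.
by apply: continuous_subspaceT => t; apply: continuous_edge_pt.
Qed.

(** Points at finite path distance have the same connected component of the
    multigraph, so such a component is open and closed; conversely each edge is
    connected, so the topological components respect the edges. *)
Lemma mgraph_connectedP : mgraph_connected G <->
  forall S : vertex G -> Prop, (forall e, S (src e) <-> S (tgt e)) ->
    (exists v, S v) -> forall v, S v.
Proof.
split=> [Gc S Scl [v0 Sv0]|Gc].
  pose A : set (mpoint G) := fun p =>
    match p with inl v => S v | inr (existT e _) => S (src e) end.
  have AE e t : A (edge_pt e t) <-> S (src e).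
    have [t0|t0] := leP t 0; first by rewrite edge_pt_src.
    have [te|te] := leP (len e) t; first by rewrite edge_pt_tgt //= Scl.
    have ht : 0 < t < len e by rewrite t0.
    by rewrite (edge_pt_inside ht).
  have Apath p q l : path_len p q l -> A p <-> A q.
    elim=> {p q l} // e s t q l _ _ _ <-.
    by rewrite !AE.
  have Aball p q : ball p 1 q -> A p <-> A q by move=> /pballE[l /Apath].
  suff AT : A = setT by move=> v; have : A (inl v) by rewrite AT.
  apply: Gc; first by exists (inl v0).
    exists A; rewrite ?setTI // openE => p Ap; apply/nbhs_ballP.
    by exists 1 => //= q /Aball <-.
  exists A; rewrite ?setTI // -openC openE => p Ap; apply/nbhs_ballP.
  by exists 1 => //= q /Aball pq /pq.
have [[v0 _]|V0] := pselect (exists v : vertex G, True); last first.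
  rewrite /mgraph_connected (_ : [set: mpoint G] = set0).
    exact: connected0.
  apply/seteqP; split => // -[v|[e u]] _; case: V0; first by exists v.
  by exists (src e).
pose C := connected_component [set: mpoint G].
have Ce e s t : C (edge_pt e s) (edge_pt e t).
  exists (edge_pt e @` [set: R]); last by exists t.
  by split; [exists s|exact: subsetT|apply: edge_connected].
have Cv v : C (inl v0) (inl v).
  apply: (Gc (fun v => C (inl v0) (inl v))) => [e|]; last first.
    by exists v0; apply: connected_component_refl.
  rewrite -(edge_pt_src e (lexx 0)) -(edge_pt_tgt (lexx (len e))).
  by split=> H; apply: connected_component_trans H (Ce _ _ _).
rewrite /mgraph_connected (_ : [set: mpoint G] = C (inl v0)).
  exact: component_connected.
apply/seteqP; split=> // p _; have [[v ->]|[e [t [ht ->]]]] := mpointP p.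
  exact: Cv.
apply: connected_component_trans (Cv (src e)) _.
by rewrite -(edge_pt_src e (lexx 0)); apply: Ce.
Qed.

End connectivity.

(** * Subgraphs *)

Section subgraphs.
Context {R : realType} {G : mgraph R}.
Implicit Types (O : subgraph G) (e : edge G) (p : mpoint G) (s t r : R).

Definition stop O (f : edge O) : R := start f + len f.

Definition vdeg O (w : vertex O) : nat := edge_ends (inl w : mpoint O).

Lemma start_lt_stop O (f : edge O) : start f < stop f.
Proof. by rewrite /stop ltrDl len_gt0. Qed.

Lemma proj_edge_pt O (f : edge O) t : 0 <= t <= len f ->
  proj (edge_pt f t) = edge_pt (carrier f) (start f + t).
Proof.
move=> /andP[t0 tf]; have [t0'|t0'] := leP t 0.
  by rewrite edge_pt_src //= place_src; congr edge_pt; lra.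
have [tf'|tf'] := leP (len f) t.
  by rewrite edge_pt_tgt //= place_tgt; congr edge_pt; lra.
have ht : 0 < t < len f by rewrite t0'.
by rewrite (edge_pt_inside ht).
Qed.

Lemma sub_supportP O p : sub_support O p <->
  exists (f : edge O) t, start f <= t <= stop f /\ p = edge_pt (carrier f) t.
Proof.
split=> [[q _ <-]|[f [t [ft ->]]]]; last first.
  exists (edge_pt f (t - start f)) => //; rewrite proj_edge_pt.
    by congr edge_pt; lra.
  by move: ft; rewrite /stop; lra.
have [[w ->]|[f [t [ft ->]]]] := mpointP q.
  have [f [<-|<-]] := vertex_end w; have := start_lt_stop f => ?.
    by exists f, (start f); split; [lra|rewrite /= place_src].
  by exists f, (stop f); split; [lra|rewrite /= place_tgt].
exists f, (start f + t); rewrite proj_edge_pt; last by lra.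
by rewrite /stop; split => //; lra.
Qed.

Lemma inside_carrier O (f : edge O) t : start f < t < stop f ->
  0 < t < len (carrier f).
Proof.
by have := start_ge0 f; have := stop_le f; rewrite /stop; lra.
Qed.

Lemma same_position O (f g : edge O) t : carrier f = carrier g ->
  start f < t < stop f -> start g <= t <= stop g -> f = g.
Proof.
move=> fg tf tg; apply: contrapT => /edges_disjoint => /(_ fg).
by move: tf tg; rewrite /stop; lra.
Qed.

(** The edges of a subgraph do not overlap, so a point inside one of them is
    not a cut point. *)
Lemma proj_inside_inj O (f : edge O) t (q : mpoint O) : start f < t < stop f ->
  proj q = edge_pt (carrier f) t -> q = edge_pt f (t - start f).
Proof.
move=> ft; have ht := inside_carrier ft.
have main (g : edge O) s : 0 <= s <= len g ->
    proj (edge_pt g s) = edge_pt (carrier f) t -> edge_pt g s = edge_pt f (t - start f).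
  move=> gs; rewrite proj_edge_pt // => /esym E.
  have [gf st] := edge_pt_inj ht E.
  have fg : f = g by apply: (same_position (esym gf) ft); rewrite -st /stop; lra.
  by subst g; congr edge_pt; lra.
have [[w ->]|[g [s [gs ->]]]] := mpointP q; last by apply: main; lra.
have [g [<-|<-]] := vertex_end w; have := len_gt0 g => ?.
  by rewrite -(edge_pt_src g (lexx 0)); apply: main; lra.
by rewrite -(edge_pt_tgt (lexx (len g))); apply: main; lra.
Qed.

Lemma inside_interior O (f : edge O) t : start f < t < stop f ->
  interior (sub_support O) (edge_pt (carrier f) t).
Proof.
move=> ft; apply/nbhs_ballP; exists (Num.min (t - start f) (stop f - t)).
  by rewrite /= lt_min; lra.
have := start_ge0 f; have := stop_le f; rewrite -/(stop f) => ? ?.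
move=> q /ball_inside[| |s -> ]; rewrite ?ge_min ?lt_min.
- by apply/orP; left; lra.
- by apply/orP; right; lra.
rewrite !ltr_norml => /andP[/andP[? ?] /andP[? ?]].
by apply/sub_supportP; exists f, s; split => //; lra.
Qed.

Lemma boundary_vertex O (q : mpoint O) : boundary_points O (proj q) ->
  exists w, q = inl w.
Proof.
have [[w ->]|[f [t [ft ->]]]] := mpointP q; first by exists w.
have ft' : start f < start f + t < stop f by rewrite /stop; lra.
rewrite proj_edge_pt; last by lra.
move=> [[_ []]|[q1 [q2 [q12 E1 E2]]]]; first exact: inside_interior.
by case: q12; rewrite (proj_inside_inj ft' E1) (proj_inside_inj ft' E2).
Qed.

Lemma interior_edge_pt (A : set (mpoint G)) e t : interior A (edge_pt e t) ->
  exists2 r, 0 < r & forall s, `|t - s| < r -> A (edge_pt e s).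
Proof.
move=> /nbhs_ballP[r /= r0 rA]; exists r => // s ts.
by apply/rA/ball_edge_pt.
Qed.

Lemma nonboundary_vertex O (w : vertex O) : ~ boundary_points O (place w) ->
  interior (sub_support O) (place w) /\
  forall q : mpoint O, proj q = place w -> q = inl w.
Proof.
move=> nb; split=> [|q qw].
  apply: contrapT => ni; apply: nb; left; split => //.
  by apply: subset_closure; exists (inl w).
apply: contrapT => qw'; apply: nb; right.
by exists q, (inl w).
Qed.

(** Where [w] is not a boundary point, the subgraph covers a neighbourhood, and
    [w] is the only descendant: so the edge of the subgraph that covers the
    edge end of the graph at [t] has its own end there, attached to [w].  This
    lemma and the next one treat the two directions along an edge. *)
Lemma nonboundary_tgt O (w : vertex O) e t : ~ boundary_points O (place w) ->
  place w = edge_pt e t -> 0 < t <= len e ->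
  exists f : edge O, [/\ carrier f = e, stop f = t & tgt f = w].
Proof.
move=> /nonboundary_vertex[+ uniq] => /[swap] we; rewrite we.
move=> /interior_edge_pt[r r0 rA] /andP[t0 te].
(* [s] is so close to [t] that no edge of the subgraph stops in [s, t[; hence
   the edge that covers [s] reaches [t]. *)
pose M := \big[Num.max/Num.max 0 (t - r)]_(f : edge O | stop f < t) stop f.
have Mt : M < t by apply: bigmax_lt => //; rewrite gt_max; lra.
have M0 : Num.max 0 (t - r) <= M by apply: bigmax_ge_id.
have {M0} [M0 Mr] : 0 <= M /\ t - r <= M by move: M0; rewrite ge_max => /andP.
pose s := (M + t) / 2.
have /sub_supportP[f [s' [fs' E]]] : sub_support O (edge_pt e s).
  by apply: rA; rewrite ger0_norm /s; lra.
have [|fe ss'] := edge_pt_inj _ E; first by rewrite /s; lra.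
rewrite {s' E}ss' in fs'.
have tf : t <= stop f.
  have [//|ft] := leP t (stop f).
  have : stop f <= M by rewrite /M (bigmax_sup f).
  by move: fs'; rewrite /s; lra.
have ft : start f < t by move: fs'; rewrite /s; lra.
have [ft'|tf'] := ltP t (stop f).
  have ft2 : start f < t < stop f by lra.
  have : proj (inl w : mpoint O) = edge_pt (carrier f) t by rewrite fe -we.
  move=> /(proj_inside_inj ft2); rewrite edge_pt_inside //.
  by move: ft2; rewrite /stop; lra.
exists f; split; rewrite ?fe //; first by lra.
have /uniq[//] : proj (inl (tgt f) : mpoint O) = place w.
by rewrite we /= place_tgt fe; congr edge_pt; rewrite -/(stop f); lra.
Qed.

Lemma nonboundary_src O (w : vertex O) e t : ~ boundary_points O (place w) ->
  place w = edge_pt e t -> 0 <= t < len e ->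
  exists f : edge O, [/\ carrier f = e, start f = t & src f = w].
Proof.
move=> /nonboundary_vertex[+ uniq] => /[swap] we; rewrite we.
move=> /interior_edge_pt[r r0 rA] /andP[t0 te].
pose M := \big[Num.min/Num.min (len e) (t + r)]_(f : edge O | t < start f) start f.
have Mt : t < M by apply: lt_bigmin => //; rewrite lt_min; lra.
have M0 : M <= Num.min (len e) (t + r) by apply: bigmin_le_id.
have {M0} [M0 Mr] : M <= len e /\ M <= t + r by move: M0; rewrite le_min => /andP.
pose s := (M + t) / 2.
have /sub_supportP[f [s' [fs' E]]] : sub_support O (edge_pt e s).
  by apply: rA; rewrite distrC ger0_norm /s; lra.
have [|fe ss'] := edge_pt_inj _ E; first by rewrite /s; lra.
rewrite {s' E}ss' in fs'.
have tf : start f <= t.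
  have [//|ft] := leP (start f) t.
  have : M <= start f by apply: bigmin_le_cond.
  by move: fs'; rewrite /s; lra.
have ft : t < stop f by move: fs'; rewrite /s; lra.
have [ft'|tf'] := ltP (start f) t.
  have ft2 : start f < t < stop f by lra.
  have : proj (inl w : mpoint O) = edge_pt (carrier f) t by rewrite fe -we.
  move=> /(proj_inside_inj ft2); rewrite edge_pt_inside //.
  by move: ft2; rewrite /stop; lra.
exists f; split; rewrite ?fe //; first by lra.
have /uniq[//] : proj (inl (src f) : mpoint O) = place w.
by rewrite we /= place_src fe; congr edge_pt; lra.
Qed.

(** Hence the effective degree vanishes at a vertex that is not a boundary
    point. *)
Lemma nonboundary_degree O (w : vertex O) : ~ boundary_points O (place w) ->
  (edge_ends (place w) <= vdeg w)%N.
Proof.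
move=> nb; rewrite /vdeg edge_endsE; have [[v wv]|[e [t [ht wt]]]] := mpointP (place w).
  rewrite wv edge_endsE.
  pose h (x : edge O * bool) := (carrier x.1, x.2).
  apply: (leq_trans _ (leq_imset_card h _)); apply: subset_leq_card.
  apply/fintype.subsetP => -[e b]; rewrite inE /end_vertex /= => /eqP ev.
  have e0 := len_gt0 e; case: b ev => ev.
    have [||f [fe _ fw]] := @nonboundary_tgt O w e (len e) nb; rewrite ?e0 ?lexx //.
      by rewrite edge_pt_tgt // ev.
    by apply/imsetP; exists (f, true); rewrite ?inE /end_vertex /= ?fw ?/h /= ?fe.
  have [||f [fe _ fw]] := @nonboundary_src O w e 0 nb; rewrite ?e0 ?lexx //.
    by rewrite edge_pt_src // ev.
  by apply/imsetP; exists (f, false); rewrite ?inE /end_vertex /= ?fw ?/h /= ?fe.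
have [|f [_ _ fw]] := @nonboundary_tgt O w e t nb wt; first by lra.
have [|g [_ _ gw]] := @nonboundary_src O w e t nb wt; first by lra.
rewrite wt edge_pt_inside /= (_ : 2%N = #|[set (f, true); (g, false)]%SET|); last first.
  by rewrite cards2 xpair_eqE andbF.
by apply: subset_leq_card; apply/fintype.subsetP => x; rewrite !inE =>
  /orP[]/eqP ->; rewrite /end_vertex /= ?fw ?gw.
Qed.

Definition vertex_eff_deg O (w : vertex O) : nat :=
  minn (vdeg w) (edge_ends (place w) - vdeg w).

(** The boundary consists of vertices, and the other vertices contribute 0: so
    the sum may run over all vertices, which eliminates the topology. *)
Lemma boundary_sizeE O :
  boundary_size O = (\sum_(w : vertex O) vertex_eff_deg w)%N%:R.
Proof.
have effE w : eff_deg (inl w : mpoint O) = vertex_eff_deg w.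
  by rewrite /eff_deg ball_degree_vertex.
rewrite /boundary_size (@fsbig_widen _ _ _ _ _ (inl @` [set: vertex O])); first last.
- move=> _ [[w _ <-] nb] /=; rewrite effE /vertex_eff_deg.
  by have /nonboundary_degree := nb; rewrite -subn_eq0 => /eqP ->; rewrite minn0.
- by move=> q /boundary_vertex[w ->]; exists w.
rewrite (@fsbigE _ _ _ _ _ [seq inl w | w <- index_enum (vertex O)]).
- rewrite big_map natr_sum; apply: congr_big => // [w|w _]; last by rewrite effE.
  by apply/mem_set; exists w.
- by rewrite map_inj_uniq ?index_enum_uniq // => ? ? [].
- by move=> q /= /mapP[w _ ->]; exists w.
- move=> _ [w _ <-]; case/negP; apply/mapP.
  by exists w => //; apply: mem_index_enum.
Qed.

End subgraphs.

(** * Partitions *)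

Section partitions.
Context {R : realType} {G : mgraph R}.
Implicit Types (O : subgraph G) (e : edge G) (p : mpoint G) (s t r : R).

Lemma infinite_segment (A : set (mpoint G)) e (a b : R) :
  0 <= a -> a < b -> b <= len e -> (forall t, a < t < b -> A (edge_pt e t)) ->
  ~ finite_set A.
Proof.
move=> a0 ab be eA finA; pose h (n : nat) : R := a + (b - a) / (n%:R + 2).
have n2 n : 0 < n%:R + 2 :> R by rewrite ltr_wpDl.
have hP n : a < h n < b.
  rewrite /h ltrDl divr_gt0 ?n2 ?subr_gt0 //= -ltrBrDl ltr_pdivrMr ?n2 //.
  rewrite ltr_pMr ?subr_gt0 //; have : 0 <= n%:R :> R by [].
  by lra.
have h_inj : injective h.
  move=> m n /addrI /(mulfI (lt0r_neq0 _)); rewrite subr_gt0 => /(_ ab).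
  by move=> /invr_inj /addIr /eqP; rewrite eqr_nat => /eqP.
apply: infinite_nat.
have : finite_set ((fun n => edge_pt e (h n)) @` [set: nat]).
  by apply: sub_finite_set finA => _ [n _ <-]; apply: eA.
rewrite /finite_set => -[m]; rewrite (card_eql (inj_card_eq _)); first by exists m.
move=> x y _ _ /= hh; have := hP x => hx; apply: h_inj.
by have [|_ ->] := edge_pt_inj _ hh; first by lra.
Qed.

Definition nonoverlapping (O1 O2 : subgraph G) : Prop :=
  forall (f : edge O1) (g : edge O2), carrier f = carrier g ->
    stop f <= start g \/ stop g <= start f.

Lemma nonoverlapping_sym O1 O2 : nonoverlapping O1 O2 -> nonoverlapping O2 O1.
Proof. by move=> O12 f g /esym /O12[]; [right|left]. Qed.

(** Two overlapping edges share a segment, which is infinite.  Otherwise a common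
    point is never inside an edge of [O1], so it is the place of a vertex. *)
Lemma finite_inter_nonoverlapping O1 O2 :
  finite_set (sub_support O1 `&` sub_support O2) <-> nonoverlapping O1 O2.
Proof.
split=> [fin f g fg|disj].
  have [|gf] := leP (stop f) (start g); first by left.
  have [|fg'] := leP (stop g) (start f); first by right.
  exfalso; have := start_lt_stop f; have := start_lt_stop g => ? ?.
  have := start_ge0 f; have := stop_le f; rewrite -/(stop f) => ? ?.
  apply: (@infinite_segment _ (carrier f) (Num.max (start f) (start g))
    (Num.min (stop f) (stop g)) _ _ _ _ fin).
  - by rewrite le_max; apply/orP; left; lra.
  - by rewrite gt_max !lt_min; apply/andP; split; apply/andP; split; lra.
  - by rewrite ge_min; apply/orP; left; lra.
  - move=> t; rewrite gt_max lt_min => /andP[/andP[? ?] /andP[? ?]]; split.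
      by apply/sub_supportP; exists f, t; split => //; lra.
    by apply/sub_supportP; exists g, t; rewrite fg; split => //; lra.
apply: (@sub_finite_set _ _ (@place _ _ O1 @` [set: vertex O1])); last first.
  exact/finite_image/finite_finset.
move=> p [[q _ <-] /sub_supportP[g [t [gt qt]]]].
have [[w ->]|[f [s [fs qf]]]] := mpointP q; first by exists w.
exfalso; move: qt; rewrite qf proj_edge_pt; last by lra.
have fs' : start f < start f + s < stop f by rewrite /stop; lra.
move=> /(edge_pt_inj (inside_carrier fs'))[gf st].
have := start_lt_stop g; rewrite st in gt.
by have [] := disj f g (esym gf); lra.
Qed.

(** The point is the limit of a segment of [O2]; if it were interior to [O1],
    both would share a segment. *)
Lemma common_point_boundary O1 O2 p : nonoverlapping O1 O2 ->
  sub_support O1 p -> sub_support O2 p -> boundary_points O1 p.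
Proof.
move=> /finite_inter_nonoverlapping fin p1 /sub_supportP[g [t [gt pt]]].
left; split; first exact: subset_closure.
rewrite pt => /interior_edge_pt[r r0 rO].
have := start_lt_stop g; have := start_ge0 g; have := stop_le g.
rewrite -/(stop g) => ? ? ?.
(* A part of [g] so close to [t] that it lies in [O1]. *)
have [a [b [ab ga gb abr]]] : exists a b, [/\ a < b, start g <= a, b <= stop g &
    forall s, a < s < b -> `|t - s| < r].
  have [tg|tg] := ltP t (stop g).
    exists t, (Num.min (stop g) (t + r)); split; rewrite ?lt_min ?ge_min ?lexx //; try lra.
    by move=> s; rewrite lt_min => /and3P[? ? ?]; rewrite ltr_norml; lra.
  exists (Num.max (start g) (t - r)), t; split; rewrite ?gt_max ?le_max ?lexx //; try lra.
  by move=> s; rewrite gt_max => /andP[/andP[? ?] ?]; rewrite ltr_norml; lra.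
apply: (@infinite_segment _ (carrier g) a b _ _ _ _ fin); try lra.
move=> s sab; split; first exact/rO/abr.
by apply/sub_supportP; exists g, s; split => //; lra.
Qed.

(** The condition that common points are boundary points follows from the
    finiteness of the intersections, by [common_point_boundary]. *)
Lemma is_partitionP (k : nat) (P : 'I_k -> subgraph G) : is_partition P <->
  [/\ forall i, mgraph_connected (P i), forall i, exists f : edge (P i), True &
      forall i j, i <> j -> nonoverlapping (P i) (P j)].
Proof.
split=> [[Pc Pi Pf _]|[Pc Pe Pd]].
  split=> // [i|i j ij]; last exact/finite_inter_nonoverlapping/Pf.
  have [p /interior_subset[q _ _]] := Pi i.
  have [[w _]|[f _]] := mpointP q; last by exists f.
  by have [f _] := vertex_end w; exists f.
split=> // [i|i j ij|i j ij p [pi pj]].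
- have [f _] := Pe i; have := start_lt_stop f => ?.
  exists (edge_pt (carrier f) ((start f + stop f) / 2)).
  by apply: inside_interior; lra.
- exact/finite_inter_nonoverlapping/Pd.
- split; first exact: common_point_boundary (Pd _ _ ij) pi pj.
  exact: common_point_boundary (Pd _ _ (nesym ij)) pj pi.
Qed.

End partitions.

(** * Removing dummy vertices *)

Lemma big_sig (M : Type) (idx : M) (op : Monoid.com_law idx) (T : finType)
    (P : pred T) (F : T -> M) :
  \big[op/idx]_(x : {x | P x}) F (val x) = \big[op/idx]_(x | P x) F x.
Proof. by symmetry; exact: (big_sub P F). Qed.

Lemma edge_ends_sum (R : realType) (G : mgraph R) (v : vertex G) :
  edge_ends (inl v : mpoint G) = (\sum_e ((src e == v) + (tgt e == v)))%N.
Proof.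
rewrite big_split /= /edge_ends; congr addn;
  by rewrite -sum1_card big_mkcond; apply: eq_bigr => e _; rewrite inE; case: eqP.
Qed.

(* The edges [f] and [g] are joined at a vertex [w] inside an edge of the graph,
   which has no further edge ends: they are replaced by one edge, which keeps
   the name [f], and [w] is removed. *)
Section merging.
Context {R : realType} {G : mgraph R} (O : subgraph G) (f g : edge O).
Hypothesis fg : tgt f = src g.
Hypothesis inside : forall v, place (tgt f) <> inl v.

Let w := tgt f.

Let stop_inside : 0 < stop f < len (carrier f).
Proof.
have := start_lt_stop f; have := start_ge0 f; have := stop_le f.
rewrite -/(stop f) => + ? ?; rewrite le_eqVlt => /orP[/eqP E|]; last by lra.
by case: (inside (v := tgt (carrier f))); rewrite place_tgt edge_pt_tgt // -E.
Qed.

Let carrier_fg : carrier g = carrier f /\ start g = stop f.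
Proof.
apply: edge_pt_inj stop_inside _.
by rewrite -place_src -fg place_tgt.
Qed.

Let fNg : f <> g.
Proof.
move=> E; have := start_lt_stop g; have [_ ->] := carrier_fg.
by rewrite E ltxx.
Qed.

Let src_w x : src x = w -> x = g.
Proof.
move=> xw; have [|xf xs] := @edge_pt_inj _ _ _ (carrier x) _ (start x) stop_inside.
  by rewrite -place_src xw /w place_tgt.
have [gf gs] := carrier_fg.
have [? ?] := (start_lt_stop g, start_lt_stop x).
apply: contrapT => /edges_disjoint; rewrite -!/(stop _) xf gf => /(_ erefl).
by rewrite gs; lra.
Qed.

Let tgt_w x : tgt x = w -> x = f.
Proof.
move=> xw; have [|xf xs] := @edge_pt_inj _ _ _ (carrier x) _ (stop x) stop_inside.
  by have := place_tgt x; rewrite xw /w place_tgt.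
have [? ?] := (start_lt_stop f, start_lt_stop x).
apply: contrapT => /edges_disjoint; rewrite -!/(stop _) xf => /(_ erefl).
by lra.
Qed.

Let medge := {x : edge O | x != g}.
Let mvertex := {y : vertex O | y != w}.
(* The edge of [O] at whose end the new edge [x] stops. *)
Let mlast (x : edge O) := if x == f then g else x.

Let msrc_subproof (x : medge) : src (val x) != w.
Proof. by case: x => x /= /eqP xg; apply/eqP => /src_w. Qed.

Let mtgt_subproof (x : medge) : tgt (mlast (val x)) != w.
Proof.
rewrite /mlast; apply/eqP; case: eqP => [_ /tgt_w /esym //|xf /tgt_w //].
Qed.

Let mlen (x : medge) := stop (mlast (val x)) - start (val x).

Let mlen_gt0 x : 0 < mlen x.
Proof.
rewrite /mlen /mlast; have := start_lt_stop (val x); case: eqP => [->|]; last by lra.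
by have := start_lt_stop g; have [_ ->] := carrier_fg; lra.
Qed.

Let mgr : mgraph R := @MGraph R mvertex medge
  (fun x => exist _ (src (val x)) (msrc_subproof x))
  (fun x => exist _ (tgt (mlast (val x))) (mtgt_subproof x)) mlen mlen_gt0.

Let carrier_mlast x : carrier (mlast x) = carrier x.
Proof. by rewrite /mlast; case: eqP => // ->; have [] := carrier_fg. Qed.

Let merged_subproof :
  [/\ forall x : medge, start (val x) + mlen x <= len (carrier (val x)),
      forall x : medge, place (tgt (mlast (val x))) =
        edge_pt (carrier (val x)) (start (val x) + mlen x),
      forall x y : medge, x <> y -> carrier (val x) = carrier (val y) ->
        start (val x) + mlen x <= start (val y) \/
        start (val y) + mlen y <= start (val x) &
      forall v : mvertex, exists x : medge,
        src (val x) = val v \/ tgt (mlast (val x)) = val v].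
Proof.
have E (x : medge) : start (val x) + mlen x = stop (mlast (val x)).
  by rewrite /mlen; lra.
split=> [x|x|x y xy cxy|[v /= vw]].
- by rewrite E -carrier_mlast stop_le.
- by rewrite E place_tgt carrier_mlast.
- have xyv : val x <> val y by move=> /val_inj.
  rewrite !E; have [? ?] := (start_lt_stop (val x), start_lt_stop (val y)).
  have /edges_disjoint/(_ cxy) := xyv; rewrite -!/(stop _).
  have [gf gs] := carrier_fg; have ? := start_lt_stop g; have ? := start_lt_stop f.
  have /eqP xg := valP x; have /eqP yg := valP y.
  have [xf|xf] := eqVneq (val x) f; have [yf|yf] := eqVneq (val y) f.
  + by case: xyv; rewrite xf yf.
  + have /edges_disjoint : g <> val y by move=> /esym.
    rewrite -!/(stop _) gf -xf cxy gs /mlast xf eqxx (negbTE yf) => /(_ erefl).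
    by lra.
  + have /edges_disjoint : g <> val x by move=> /esym.
    rewrite -!/(stop _) gf -yf -cxy gs /mlast yf eqxx (negbTE xf) => /(_ erefl).
    by lra.
  + by rewrite /mlast (negbTE xf) (negbTE yf).
- have [x [xv|xv]] := vertex_end v.
    have xg : x != g.
      by apply/eqP => xg; case/eqP: vw; rewrite -xv xg -fg.
    by exists (exist _ x xg); left.
  have [xg|xg] := eqVneq x g.
    exists (exist _ f (introN eqP fNg)); right.
    by rewrite /= /mlast eqxx -xg.
  exists (exist _ x xg); right; rewrite /= /mlast; case: eqP => // xf.
  by case/eqP: vw; rewrite -xv xf.
Qed.

Definition merged : subgraph G.
Proof.
refine (@Subgraph R G mgr (fun x => carrier (val x)) (fun x => start (val x))
  (fun v => place (val v)) _ _ _ _ _ _).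
- by move=> x; apply: start_ge0.
- by have [] := merged_subproof.
- by move=> x; apply: place_src.
- by have [] := merged_subproof.
- by have [] := merged_subproof.
- move=> v; have [_ _ _ vend] := merged_subproof.
  by have [x [xv|xv]] := vend v; exists x; [left|right]; exact: val_inj.
Defined.

Lemma merged_card : (#|edge merged| < #|edge O|)%N.
Proof.
rewrite card_sig (cardD1 g predT) add1n ltnS; apply: subset_leq_card.
by apply/fintype.subsetP => x; rewrite !inE andbT.
Qed.

Let sum_merged (M : nmodType) (F : edge O -> edge O -> M) :
  \sum_(x : medge) F (val x) (mlast (val x)) =
  F f g + \sum_(x | (x != g) && (x != f)) F x x.
Proof.
rewrite (@big_sig _ _ _ _ (fun x => x != g) (fun x => F x (mlast x))).
rewrite (bigD1 f) /=; last exact/eqP.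
rewrite {1}/mlast eqxx; congr (_ + _); apply: eq_bigr => x /andP[_ xf].
by rewrite /mlast (negbTE xf).
Qed.

Let sum_split (M : nmodType) (F : edge O -> M) :
  \sum_x F x = F f + F g + \sum_(x | (x != g) && (x != f)) F x.
Proof.
rewrite (bigD1 g) //= (bigD1 f) /=; last exact/eqP.
by rewrite addrA (addrC (F f)).
Qed.

Lemma merged_length : total_length merged = total_length O.
Proof.
rewrite /total_length sum_split.
rewrite (@sum_merged _ (fun x y => stop y - start x)); congr (_ + _).
  by have [_ gs] := carrier_fg; move: gs; rewrite /stop; lra.
by apply: eq_bigr => x _; rewrite /stop; lra.
Qed.

Lemma merged_boundary : boundary_size merged <= boundary_size O.
Proof.
rewrite !boundary_sizeE ler_nat.
have vdegE (y : mvertex) : @vdeg _ _ merged y = vdeg (val y).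
  rewrite /vdeg !edge_ends_sum.
  have := @sum_merged nat (fun x z => (src x == val y) + (tgt z == val y))%N.
  rewrite /= => ->; rewrite (@sum_split nat) /=; congr addn.
  have yw : (w == val y) = false by apply/negbTE; rewrite eq_sym (valP y).
  by rewrite -fg -/w yw addn0 add0n.
apply: (@leq_trans (\sum_(y : mvertex) vertex_eff_deg (val y))).
  by apply: leq_sum => y _; rewrite /vertex_eff_deg vdegE.
rewrite (@big_sig _ _ _ _ (fun y => y != w) (@vertex_eff_deg _ _ O)).
by rewrite [X in (_ <= X)%N](bigID (fun y => y != w)) leq_addr.
Qed.

Lemma merged_connected : mgraph_connected O -> mgraph_connected merged.
Proof.
move=> /mgraph_connectedP Oc; apply/mgraph_connectedP => S Scl [v0 Sv0] v.
pose T y := (exists2 z : mvertex, val z = y & S z) \/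
  (y = w /\ exists2 z : mvertex, val z = src f & S z).
have TE (z : mvertex) : T (val z) <-> S z.
  split=> [[[z' /val_inj <- //]|[zw _]]|Sz]; last by left; exists z.
  by have := valP z; rewrite /= zw eqxx.
suff : T (val v) by rewrite TE.
apply: Oc; last by exists (val v0); rewrite TE.
have fNg' : f != g by apply/eqP.
pose f' : medge := exist _ f fNg'.
have Tw : T w <-> S (@src _ mgr f').
  split=> [[[z zw]|[_ [z zf Sz]]]|Sf].
  - by have := valP z; rewrite /= zw eqxx.
  - by have -> : @src _ mgr f' = z by apply: val_inj.
  - by right; split => //; exists (@src _ mgr f').
move=> x; have [->|xg] := eqVneq x g.
  rewrite -fg Tw Scl -TE /= /mlast eqxx; tauto.
have := Scl (exist _ x xg : medge); rewrite -!TE /=.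
have [->|xf] := eqVneq x f.
  by rewrite -/w Tw -TE.
by rewrite /mlast (negbTE xf).
Qed.

Lemma merged_nonoverlapping (O' : subgraph G) :
  nonoverlapping O O' -> nonoverlapping merged O'.
Proof.
move=> OO' x h xh.
have -> : @stop _ _ merged x = stop (mlast (val x)).
  by rewrite /stop /= /mlen /stop; lra.
have -> : @start _ _ merged x = start (val x) by [].
have := OO' (val x) h xh; rewrite /mlast; case: eqP => // xf.
have {}xh : carrier (val x) = carrier h by [].
have [gf gs] := carrier_fg; have := OO' g h; rewrite gf -xf xh gs => /(_ erefl).
rewrite xf; have := start_lt_stop f; have := start_lt_stop g; rewrite gs.
by have := start_lt_stop h; lra.
Qed.

End merging.

(** Edges are oriented like their carriers, so two edges that are joined inside an
    edge of the graph are joined at the target of one and the source of the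
    other. *)
Definition reduced (R : realType) (G : mgraph R) (O : subgraph G) : Prop :=
  forall f g : edge O, tgt f = src g -> exists v, place (tgt f) = inl v.

(** Each merging removes an edge, so finitely many of them remove all dummy
    vertices. *)
Lemma exists_reduced (R : realType) (G : mgraph R) (O : subgraph G) :
  mgraph_connected O -> exists O' : subgraph G,
  [/\ mgraph_connected O', reduced O', total_length O' = total_length O,
      boundary_size O' <= boundary_size O &
      forall O'', nonoverlapping O O'' -> nonoverlapping O' O''].
Proof.
have [n] := ubnP #|edge O|; elim: n O => // n IH O On Oc.
have [Ored|/existsNP[f /existsNP[g /not_implyP[fg inside]]]] := pselect (reduced O).
  by exists O.
have inside' v : place (tgt f) <> inl v by move=> E; apply: inside; exists v.
have [||Om [cm rm lm bm dm]] := IH (merged fg inside').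
- exact: leq_trans (merged_card _ _) On.
- exact: merged_connected.
exists Om; split => //; first by rewrite lm merged_length.
  exact: le_trans bm (merged_boundary _ _).
by move=> O' OO'; apply/dm/merged_nonoverlapping.
Qed.

(** * Skeletons: combinatorial types of reduced subgraphs *)

(** A vertex anchored at [Some v] is placed at the vertex [v] of the graph; a
    vertex with anchor [None] floats inside an edge. *)
Record skeleton (R : realType) (G : mgraph R) := Skeleton {
  sk_edge : finType;
  sk_vertex : finType;
  sk_src : sk_edge -> sk_vertex;
  sk_tgt : sk_edge -> sk_vertex;
  sk_carrier : sk_edge -> edge G;
  sk_anchor : sk_vertex -> option (vertex G) }.

Section skeleton_defs.
Context {R : realType} {G : mgraph R}.
Implicit Types K : skeleton G.

Definition incidence K (x : sk_edge K) (y : sk_vertex K) : nat :=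
  (sk_src x == y) + (sk_tgt x == y).

Definition sk_degree K (y : sk_vertex K) : nat := \sum_x incidence x y.

(** A floating vertex has degree 1, and so has effective degree 1 as long as it
    lies inside an edge.  In a limit it may reach a vertex of the graph of degree
    1, where its effective degree is 0; the value 1 is then an upper bound. *)
Definition sk_eff_deg K (y : sk_vertex K) : nat :=
  if sk_anchor y is Some v then
    minn (sk_degree y) (edge_ends (inl v : mpoint G) - sk_degree y)
  else 1.

Definition sk_boundary K : nat := \sum_(y : sk_vertex K) sk_eff_deg y.

(** The first condition is connectedness, in the form of [mgraph_connectedP]; the
    last two say that the anchors are the ends of the carriers. *)
Definition sk_good K : Prop :=
  [/\ forall S : sk_vertex K -> Prop,
        (forall x, S (sk_src x) <-> S (sk_tgt x)) ->
        (exists y, S y) -> forall y, S y,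
      forall y : sk_vertex K, ~~ sk_anchor y -> sk_degree y = 1%N,
      forall (x : sk_edge K) v, sk_anchor (sk_src x) = Some v -> v = src (sk_carrier x) &
      forall (x : sk_edge K) v, sk_anchor (sk_tgt x) = Some v -> v = tgt (sk_carrier x)].

(** Edge [x] occupies the interval [lo x, hi x] of its carrier.  Lengths 0 are
    admitted, which makes all conditions closed. *)
Definition fits K (lo hi : sk_edge K -> R) : Prop :=
  [/\ forall x, [/\ 0 <= lo x, lo x <= hi x & hi x <= len (sk_carrier x)],
      forall x, sk_anchor (sk_src x) -> lo x = 0,
      forall x, sk_anchor (sk_tgt x) -> hi x = len (sk_carrier x) &
      forall x y, x <> y -> sk_carrier x = sk_carrier y ->
        hi x <= lo y \/ hi y <= lo x].

Definition sk_length K (lo hi : sk_edge K -> R) : R := \sum_x (hi x - lo x).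

End skeleton_defs.

Section good_skeletons.
Context {R : realType} {G : mgraph R} (K : skeleton G).
Implicit Types (x : sk_edge K) (y : sk_vertex K).

Lemma incidence_src (x : sk_edge K) : (0 < incidence x (sk_src x))%N.
Proof. by rewrite /incidence eqxx. Qed.

Lemma incidence_tgt (x : sk_edge K) : (0 < incidence x (sk_tgt x))%N.
Proof. by rewrite /incidence eqxx addnC. Qed.

#[local] Hint Resolve incidence_src incidence_tgt : core.

Lemma incidenceP (x : sk_edge K) y : (0 < incidence x y)%N -> sk_src x = y \/ sk_tgt x = y.
Proof.
by rewrite /incidence addn_gt0 !lt0b => /orP[]/eqP; [left|right].
Qed.

Hypothesis Kgood : sk_good K.

Lemma floating_uniq x x' y : ~~ sk_anchor y ->
  (0 < incidence x y)%N -> (0 < incidence x' y)%N -> x = x'.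
Proof.
move=> /(let: And4 _ h _ _ := Kgood in h _) d1 xy x'y; apply/eqP/negPn/negP => xx'.
move: d1; rewrite /sk_degree (bigD1 x) //= (bigD1 x') /=; last by rewrite eq_sym.
by lia.
Qed.

Lemma floating_incidence x y : ~~ sk_anchor y -> (incidence x y <= 1)%N.
Proof.
move=> /(let: And4 _ h _ _ := Kgood in h _) d1.
by move: d1; rewrite /sk_degree (bigD1 x) //=; lia.
Qed.

(** Floating vertices have degree 1, so the two ends form a connected
    component. *)
Lemma floating_edge_unique x : ~~ sk_anchor (sk_src x) ->
  ~~ sk_anchor (sk_tgt x) -> forall x', x' = x.
Proof.
have [Kc _ _ _] := Kgood => sx tx x'.
have E : forall v, v = sk_src x \/ v = sk_tgt x.
  apply: Kc; last by exists (sk_src x); left.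
  move=> z; split=> -[] E.
  - have -> : z = x by apply: (floating_uniq sx); rewrite // -E.
    by right.
  - have -> : z = x by apply: (floating_uniq tx); rewrite // -E.
    by right.
  - have -> : z = x by apply: (floating_uniq sx); rewrite // -E.
    by left.
  - have -> : z = x by apply: (floating_uniq tx); rewrite // -E.
    by left.
have [E'|E'] := E (sk_src x').
  by apply: (floating_uniq sx); rewrite // -E'.
by apply: (floating_uniq tx); rewrite // -E'.
Qed.

End good_skeletons.

(* The subgraph with the given skeleton and positions, in which the edges of
   length 0, and the vertices that only belong to such edges, are deleted. *)
Section realization.
Context {R : realType} {G : mgraph R} (K : skeleton G).
Context (lo hi : sk_edge K -> R).
Implicit Types (x : sk_edge K) (y : sk_vertex K).
Hypothesis Kgood : sk_good K.
Hypothesis Kfits : fits lo hi.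
Hypothesis Klen : 0 < sk_length lo hi.

Let active (x : sk_edge K) := lo x < hi x.
Let used (y : sk_vertex K) := [exists x, active x && (0 < incidence x y)%N].

#[local] Hint Resolve incidence_src incidence_tgt : core.

Let lo_le_hi x : lo x <= hi x.
Proof. by have [/(_ x)[]] := Kfits. Qed.

(* A deleted edge is a stub: it is not a full edge, and if both its ends were
   floating it would be the only edge, and the total length would be 0. *)
Let floating_ends x : ~~ active x ->
  sk_anchor (sk_src x) = ~~ sk_anchor (sk_tgt x) :> bool.
Proof.
have [Kc _ Ks Kt] := Kgood; have [Fx Fs Ft _] := Kfits => nact.
case: (boolP (isSome (sk_anchor (sk_src x)))) => sx;
  case: (boolP (isSome (sk_anchor (sk_tgt x)))) => tx //.
  by move: nact; rewrite /active (Fs _ sx) (Ft _ tx) len_gt0.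
have all_x := floating_edge_unique Kgood sx tx.
move: Klen; rewrite /sk_length big1 ?ltxx // => z _; rewrite (all_x z).
by move: nact (lo_le_hi x); rewrite /active -leNgt; lra.
Qed.

Let place_subproof y : used y -> exists p : mpoint G,
  [/\ forall v, sk_anchor y = Some v -> p = inl v,
      forall x, sk_src x = y -> p = edge_pt (sk_carrier x) (lo x) &
      forall x, sk_tgt x = y -> p = edge_pt (sk_carrier x) (hi x)].
Proof.
have [_ _ Ks Kt] := Kgood; have [_ Fs Ft _] := Kfits.
move=> /existsP[x /andP[_ xy]]; case yv : (sk_anchor y) => [v|].
  exists (inl v); split=> [_ [->] //|z zy|z zy].
    have := Ks z; have := Fs z; rewrite zy yv => /(_ isT) -> /(_ _ erefl) ->.
    by rewrite edge_pt_src.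
  have := Kt z; have := Ft z; rewrite zy yv => /(_ isT) -> /(_ _ erefl) ->.
  by rewrite edge_pt_tgt.
have y0 : ~~ sk_anchor y by rewrite yv.
have /incidenceP[xs|xt] := xy.
  exists (edge_pt (sk_carrier x) (lo x)); split=> // z zy.
    by rewrite (floating_uniq Kgood (x := z) (x' := x) y0) // -zy.
  have zx : z = x by apply: (floating_uniq Kgood y0) => //; rewrite -zy.
  subst z; have := floating_incidence Kgood x y0.
  by rewrite /incidence xs zy eqxx.
exists (edge_pt (sk_carrier x) (hi x)); split=> // z zy.
  have zx : z = x by apply: (floating_uniq Kgood y0) => //; rewrite -zy.
  subst z; have := floating_incidence Kgood x y0.
  by rewrite /incidence xt zy eqxx.
by rewrite (floating_uniq Kgood (x := z) (x' := x) y0) // -zy.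
Qed.

Let redge := {x : sk_edge K | active x}.
Let rvertex := {y : sk_vertex K | used y}.

Let rsrc_subproof (x : redge) : used (sk_src (val x)).
Proof. by apply/existsP; exists (val x); rewrite (valP x) incidence_src. Qed.

Let rtgt_subproof (x : redge) : used (sk_tgt (val x)).
Proof. by apply/existsP; exists (val x); rewrite (valP x) incidence_tgt. Qed.

Let rlen_gt0 (x : redge) : 0 < hi (val x) - lo (val x).
Proof. by rewrite subr_gt0; exact: (valP x). Qed.

Let rgr : mgraph R := @MGraph R rvertex redge
  (fun f => exist _ (sk_src (val f)) (rsrc_subproof f))
  (fun f => exist _ (sk_tgt (val f)) (rtgt_subproof f))
  (fun f => hi (val f) - lo (val f)) rlen_gt0.

Let rplace (y : rvertex) : mpoint G := projT1 (cid (place_subproof (valP y))).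

Definition realize : subgraph G.
Proof.
refine (@Subgraph R G rgr (fun f => sk_carrier (val f)) (fun f => lo (val f))
  rplace _ _ _ _ _ _).
- by move=> x; have [/(_ (val x))[]] := Kfits.
- move=> x; rewrite /= addrC subrK.
  by have [/(_ (val x))[]] := Kfits.
- move=> x; rewrite /rplace; case: cid => p [_ psrc _] /=.
  exact: psrc.
- move=> x; rewrite /= addrC subrK /rplace; case: cid => p [_ _ ptgt] /=.
  exact: ptgt.
- move=> x y xy cxy; rewrite /= ![lo _ + _]addrC !subrK.
  by have [_ _ _] := Kfits; apply=> // /val_inj.
- move=> y; have /existsP[x /andP[xa]] := valP y.
  by move=> /incidenceP[xy|xy]; exists (exist _ x xa : redge); [left|right];
    apply: val_inj.
Defined.

Lemma realize_length : total_length realize = sk_length lo hi.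
Proof.
rewrite /total_length (@big_sig _ _ _ _ active (fun x => hi x - lo x)).
apply: big_rmcond => x; rewrite /active -leNgt => xa.
by have := lo_le_hi x; lra.
Qed.

Lemma realize_has_edge : exists f : edge realize, True.
Proof.
move: Klen; rewrite -realize_length => l0; apply: contrapT => noe.
move: l0; rewrite /total_length big1 ?ltxx // => f _.
by case: noe; exists f.
Qed.

Let sum_incidence (P : pred (sk_vertex K)) x :
  (\sum_(y | P y) incidence x y = P (sk_src x) + P (sk_tgt x))%N.
Proof.
have sumE a : (\sum_(y | P y) (a == y) = P a)%N.
  rewrite big_mkcond (bigD1 a) //= big1 ?addn0 ?eqxx; first by case: (P a).
  by move=> y /negbTE; rewrite eq_sym => ->; case: (P y).
by rewrite big_split /= !sumE.
Qed.

Let loss y : nat := \sum_(x | ~~ active x) incidence x y.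

(* Each deleted edge has one floating end and one anchored end. *)
Let sum_loss :
  (\sum_(y | ~~ sk_anchor y) loss y = \sum_(y | sk_anchor y) loss y)%N.
Proof.
rewrite /loss exchange_big [RHS]exchange_big /=; apply: eq_bigr => x /floating_ends.
by rewrite (@sum_incidence (fun y => ~~ sk_anchor y))
  (@sum_incidence (fun y => isSome (sk_anchor y))) => ->; case: (isSome _).
Qed.

(** At an anchored vertex the effective degree grows by at most the number of
    edge ends deleted there.  This is compensated by the deleted floating
    vertices: there is one for each deleted edge, and each contributed 1. *)
Lemma realize_boundary : boundary_size realize <= (sk_boundary K)%:R.
Proof.
rewrite boundary_sizeE ler_nat.
pose rdeg y := (\sum_(x | active x) incidence x y)%N.
have rdegE (y : vertex realize) : vdeg y = rdeg (val y).
  rewrite /vdeg edge_ends_sum.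
  by rewrite /rdeg -(@big_sig _ _ _ _ active (fun x => incidence x (val y))).
have degE y : sk_degree y = (rdeg y + loss y)%N.
  by rewrite /sk_degree (bigID active).
(* The contribution of [y] after the deletion. *)
pose c y := (if used y then
  if sk_anchor y is Some v then minn (rdeg y) (edge_ends (inl v : mpoint G) - rdeg y)
  else rdeg y else 0)%N.
apply: (@leq_trans (\sum_y c y)).
  rewrite [X in (_ <= X)%N](bigID used) /=; apply: leq_trans (leq_addr _ _).
  rewrite -(@big_sig _ _ _ _ used c); apply: leq_sum => y _.
  rewrite /vertex_eff_deg /c (valP y) rdegE.
  case yv : (sk_anchor (val y)) => [v|]; last by rewrite geq_minl.
  have -> // : place (y : vertex realize) = inl v.
  by rewrite /= /rplace; case: cid => p [pv _ _] /=; exact: pv.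
rewrite /sk_boundary -(leq_add2r (\sum_(y | ~~ sk_anchor y) loss y)) {2}sum_loss.
rewrite (bigID (fun y => isSome (sk_anchor y))) /=.
rewrite [X in (_ <= X + _)%N](bigID (fun y => isSome (sk_anchor y))) /=.
rewrite -addnA -big_split /= addnAC -big_split /=; apply: leq_add.
  apply: leq_sum => y ya; rewrite /c /sk_eff_deg; case: (sk_anchor y) ya => // v _.
  by case: ifP => _ //; rewrite degE; lia.
apply: leq_sum => y ya; have d1 : sk_degree y = 1%N by have [_ + _ _] := Kgood; exact.
rewrite /c /sk_eff_deg; case: (sk_anchor y) ya => // _.
by move: d1; rewrite degE; case: ifP => _; lia.
Qed.

(** A set of remaining vertices that is closed under the remaining edges extends
    to all vertices: the floating end of a deleted stub belongs to it when its
    anchored end does. *)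
Lemma realize_connected : mgraph_connected realize.
Proof.
have [Kc _ _ _] := Kgood.
apply/mgraph_connectedP => S Scl [v0 Sv0] v.
pose T y := (exists2 z : rvertex, val z = y & S z) \/
  (~~ sk_anchor y && ~~ used y /\ exists x (z : rvertex),
    [/\ ~~ active x, (0 < incidence x y)%N, (0 < incidence x (val z))%N & S z]).
have TE (z : rvertex) : T (val z) <-> S z.
  split=> [[[z' /val_inj <- //]|[/andP[_]]]|Sz]; last by left; exists z.
  by rewrite (valP z).
suff : T (val v) by rewrite TE.
apply: Kc; last by exists (val v0); rewrite TE.
move=> x; have [xa|xa] := boolP (active x).
  have := Scl (exist _ x xa : redge); by rewrite -!TE.
have floating_unused y : ~~ sk_anchor y -> (0 < incidence x y)%N -> ~~ used y.
  move=> y0 xy; apply/negP => /existsP[x' /andP[x'a x'y]].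
  by move: xa; rewrite (floating_uniq Kgood y0 xy x'y) x'a.
have aux y y' : ~~ sk_anchor y -> sk_anchor y' -> (0 < incidence x y)%N ->
    (0 < incidence x y')%N -> T y <-> T y'.
  move=> y0 y1 xy xy'; have yu := floating_unused y y0 xy.
  split=> [[[z zy]|[_ [x' [z [x'a x'y x'z Sz]]]]]|[[z zy Sz]|[/andP[/negP//]]]].
  - by move: yu; rewrite -zy (valP z).
  - have E := floating_uniq Kgood y0 x'y xy; subst x'; left; exists z => //.
    have zy : val z != y by apply: contraNneq yu => <-; exact: valP z.
    have yy' : y' != y by apply: contraNneq y0 => <-.
    move: xy xy' x'z zy yy' => /incidenceP[]<- /incidenceP[]<- /incidenceP[]<-;
      by rewrite ?eqxx.
  - right; split; first by rewrite y0.
    by exists x, z; rewrite zy.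
have := floating_ends xa.
case: (boolP (isSome (sk_anchor (sk_src x)))) => sx;
  case: (boolP (isSome (sk_anchor (sk_tgt x)))) => tx // _.
  by rewrite (aux _ _ tx sx).
by rewrite (aux _ _ sx tx).
Qed.

End realization.

(** * The skeleton of a reduced subgraph *)

Section skeleton_of_subgraph.
Context {R : realType} {G : mgraph R} (O : subgraph G).

Definition anchor_of (p : mpoint G) : option (vertex G) :=
  if p is inl v then Some v else None.

Definition skeleton_of : skeleton G :=
  @Skeleton R G (edge O) (vertex O) (@src _ O) (@tgt _ O) (@carrier _ _ O)
    (fun w => anchor_of (place w)).

Let anchor_src (f : edge O) v : anchor_of (place (src f)) = Some v ->
  start f = 0 /\ v = src (carrier f).
Proof.
have := start_lt_stop f; have := start_ge0 f; have := stop_le f.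
rewrite place_src -/(stop f); case E : edge_pt => [u|//] ? ? ? [<-].
by have [|[s0 us]|[sl _]] := edge_pt_inl _ E; [lra|split|exfalso; clear E; lra].
Qed.

Let anchor_tgt (f : edge O) v : anchor_of (place (tgt f)) = Some v ->
  stop f = len (carrier f) /\ v = tgt (carrier f).
Proof.
have := start_lt_stop f; have := start_ge0 f; have := stop_le f.
rewrite place_tgt -/(stop f); case E : edge_pt => [u|//] ? ? ? [<-].
by have [|[s0 _]|[sl us]] := edge_pt_inl _ E;
  [rewrite -/(stop f); lra|exfalso; clear E; move: s0; rewrite -/(stop f); lra|split].
Qed.

Lemma skeleton_of_fits : @fits _ _ skeleton_of (@start _ _ O) (@stop _ _ O).
Proof.
split=> [f|f /=|f /=|f g fg cfg].
- by rewrite start_ge0 (ltW (start_lt_stop f)) stop_le.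
- by case E : anchor_of => [v|//] _; have [] := anchor_src E.
- by case E : anchor_of => [v|//] _; have [] := anchor_tgt E.
- exact: edges_disjoint.
Qed.

Lemma skeleton_of_length : @sk_length _ _ skeleton_of (@start _ _ O) (@stop _ _ O) =
  total_length O.
Proof. by apply: eq_bigr => f _; rewrite /stop; lra. Qed.

Let same_start (f g : edge O) : carrier f = carrier g -> start f = start g -> f = g.
Proof.
move=> cfg fg; have [? ?] := (start_lt_stop f, start_lt_stop g).
by apply: contrapT => /edges_disjoint/(_ cfg); rewrite -!/(stop _); lra.
Qed.

Let same_stop (f g : edge O) : carrier f = carrier g -> stop f = stop g -> f = g.
Proof.
move=> cfg fg; have [? ?] := (start_lt_stop f, start_lt_stop g).
by apply: contrapT => /edges_disjoint/(_ cfg); rewrite -!/(stop _); lra.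
Qed.

Hypothesis Ored : reduced O.

(* Inside an edge only two edges of [O] can end, one from each side, and in a
   reduced subgraph they do not share a vertex. *)
Let floating_degree (w : vertex O) : ~~ anchor_of (place w) ->
  @sk_degree _ _ skeleton_of w = 1%N.
Proof.
move=> w0.
have red f g : tgt f = w -> src g = w -> False.
  move=> fw gw; have [|v E] := Ored (f := f) (g := g); first by rewrite fw gw.
  by move: w0; rewrite -fw E.
have [e [t [te wt]]] : exists e t, 0 < t < len e /\ place w = edge_pt e t.
  by move: w0; have [[v ->]|[e [t [te ->]]]] := mpointP (place w) => // _; exists e, t.
have src_inj f g : src f = w -> src g = w -> f = g.
  move=> fw gw; have := place_src f; have := place_src g.
  rewrite fw gw wt => /(edge_pt_inj te)[cg sg] /(edge_pt_inj te)[cf sf].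
  by apply: same_start; rewrite ?cf ?sf.
have tgt_inj f g : tgt f = w -> tgt g = w -> f = g.
  move=> fw gw; have := place_tgt f; have := place_tgt g.
  rewrite fw gw wt => /(edge_pt_inj te)[cg sg] /(edge_pt_inj te)[cf sf].
  by apply: same_stop; rewrite /stop ?cf ?sf.
have [f [fw|fw]] := vertex_end w; rewrite /sk_degree (bigD1 f) //= big1 => [|g gf];
  rewrite /incidence /= ?fw ?eqxx ?addn0.
- by case: eqP => // /red /(_ fw).
- case: eqP => [gw|_]; first by rewrite (src_inj g f) ?eqxx in gf.
  by case: eqP => // /red /(_ fw).
- by case: eqP => // /(red _ _ fw).
- case: eqP => [/(red _ _ fw)//|_]; case: eqP => // gw.
  by rewrite (tgt_inj g f) ?eqxx in gf.
Qed.

Lemma skeleton_of_good : mgraph_connected O -> sk_good skeleton_of.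
Proof.
move=> /mgraph_connectedP Oc; split=> //= [f v|f v].
  by case/anchor_src.
by case/anchor_tgt.
Qed.

(** A floating vertex has degree 1 at a point of degree 2. *)
Lemma skeleton_of_boundary : boundary_size O = (sk_boundary skeleton_of)%:R.
Proof.
rewrite boundary_sizeE; congr (_%:R); apply: eq_bigr => w _.
have dE : vdeg w = @sk_degree _ _ skeleton_of w by rewrite /vdeg edge_ends_sum.
rewrite /sk_eff_deg -dE /vertex_eff_deg /=.
case E : (place w) => [v|u] //=.
by rewrite dE floating_degree ?E.
Qed.

(** Edges do not overlap, so an edge that reaches an end of its carrier is
    determined by the carrier and this end; an edge that reaches neither is the
    only edge, by [floating_edge_unique]. *)
Lemma reduced_card_edge : mgraph_connected O -> (#|edge O| <= #|edge G| * 4)%N.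
Proof.
move=> /skeleton_of_good good.
have -> : (#|edge G| * 4 = #|{: edge G * (bool * bool)}|)%N.
  by rewrite !card_prod card_bool.
apply: (leq_card (fun f : edge O =>
  (carrier f, (start f == 0, stop f == len (carrier f))))).
move=> f g [cfg]; have [sf|sf] := eqVneq (start f) 0.
  by move=> /esym/eqP sg _; apply: same_start; rewrite // sf sg.
move=> _; have [tf|tf] := eqVneq (stop f) (len (carrier f)).
  by move=> /esym/eqP tg; apply: same_stop; rewrite // tf tg cfg.
move=> _; have [_ Fs Ft _] := skeleton_of_fits.
apply/esym/(floating_edge_unique good).
  by apply: contra_neqN sf => /(Fs f).
by apply: contra_neqN tf => /(Ft f).
Qed.

Lemma card_vertex : (#|vertex O| <= #|edge O| * 2)%N.
Proof.
rewrite -card_bool -card_prod -!cardsT.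
apply: leq_trans (leq_imset_card (@end_vertex _ O) _).
apply: subset_leq_card; apply/fintype.subsetP => w _; apply/imsetP.
by have [f [<-|<-]] := vertex_end w; [exists (f, false)|exists (f, true)]; rewrite ?inE.
Qed.

End skeleton_of_subgraph.

(** * Finitely many skeletons *)

Section relabelling.
Context {R : realType} {G : mgraph R} (K K' : skeleton G).
Context (h : sk_edge K -> sk_edge K') (h' : sk_vertex K -> sk_vertex K').
Hypotheses (h_bij : bijective h) (h'_bij : bijective h').
Hypothesis h_src : forall x, sk_src (h x) = h' (sk_src x).
Hypothesis h_tgt : forall x, sk_tgt (h x) = h' (sk_tgt x).
Hypothesis h_carrier : forall x, sk_carrier (h x) = sk_carrier x.
Hypothesis h_anchor : forall y, sk_anchor (h' y) = sk_anchor y.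

Let relabel_degree y : sk_degree (h' y) = sk_degree y.
Proof.
rewrite /sk_degree (reindex h) /=; last exact: onW_bij.
apply: eq_bigr => x _; rewrite /incidence h_src h_tgt.
by rewrite !(inj_eq (bij_inj h'_bij)).
Qed.

Lemma relabel_boundary : sk_boundary K = sk_boundary K'.
Proof.
rewrite /sk_boundary [RHS](reindex h') /=; last exact: onW_bij.
by apply: eq_bigr => y _; rewrite /sk_eff_deg h_anchor relabel_degree.
Qed.

Lemma relabel_good : sk_good K' -> sk_good K.
Proof.
move=> [Kc Kd Ks Kt]; split.
- move=> S Scl [y0 Sy0] y; have [g' h'K g'K] := h'_bij.
  suff : S (g' (h' y)) by rewrite h'K.
  apply: (Kc (fun z => S (g' z))); last by exists (h' y0); rewrite h'K.
  have [g hK gK] := h_bij => x.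
  by rewrite -(gK x) h_src h_tgt !h'K.
- by move=> y y0; rewrite -relabel_degree; apply: Kd; rewrite h_anchor.
- by move=> x v xv; rewrite -h_carrier; apply: Ks; rewrite h_src h_anchor.
- by move=> x v xv; rewrite -h_carrier; apply: Kt; rewrite h_tgt h_anchor.
Qed.

Lemma relabel_fits (lo hi : sk_edge K' -> R) : fits lo hi ->
  fits (K := K) (lo \o h) (hi \o h).
Proof.
move=> [Fx Fs Ft Fd]; split=> [x|x xa|x xa|x y xy cxy] /=.
- by rewrite -h_carrier.
- by apply: Fs; rewrite h_src h_anchor.
- by rewrite -h_carrier; apply: Ft; rewrite h_tgt h_anchor.
- by apply: Fd; [move=> /(bij_inj h_bij)|rewrite !h_carrier].
Qed.

Lemma relabel_length (lo hi : sk_edge K' -> R) :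
  sk_length (K := K) (lo \o h) (hi \o h) = sk_length lo hi.
Proof.
by rewrite /sk_length [RHS](reindex h) //=; apply: onW_bij.
Qed.

End relabelling.

(* A skeleton with at most [N] edges and [N] vertices is encoded by an element of
   a finite type, by numbering its edges and vertices. *)
Section codes.
Context {R : realType} (G : mgraph R) (N : nat).

Definition code_fiber (nm : 'I_N.+1 * 'I_N.+1) : finType :=
  ({ffun 'I_nm.1 -> 'I_nm.2 * 'I_nm.2 * edge G} *
   {ffun 'I_nm.2 -> option (vertex G)})%type.

Definition code : finType := {nm : 'I_N.+1 * 'I_N.+1 & code_fiber nm}.

Definition skeleton_of_code (c : code) : skeleton G :=
  @Skeleton R G 'I_(tag c).1 'I_(tag c).2
    (fun x => ((tagged c).1 x).1.1) (fun x => ((tagged c).1 x).1.2)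
    (fun x => ((tagged c).1 x).2) (fun y => (tagged c).2 y).

Definition edge_index (c : code) (x : sk_edge (skeleton_of_code c)) : nat :=
  nat_of_ord (x : 'I_(tag c).1).

(** The positions are indexed by [nat], so that their type does not depend on the
    code, and limits of positions make sense before the code is fixed. *)
Lemma exists_code (K : skeleton G) (lo hi : sk_edge K -> R) :
  (#|sk_edge K| <= N)%N -> (#|sk_vertex K| <= N)%N -> sk_good K -> fits lo hi ->
  exists (c : code) (lo' hi' : nat -> R),
  [/\ sk_good (skeleton_of_code c),
      fits (lo' \o @edge_index c) (hi' \o @edge_index c),
      sk_boundary (skeleton_of_code c) = sk_boundary K,
      sk_length (lo' \o @edge_index c) (hi' \o @edge_index c) = sk_length lo hi &
      exists h : sk_edge (skeleton_of_code c) -> sk_edge K, bijective h /\ forall x,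
        [/\ sk_carrier (h x) = sk_carrier x, lo (h x) = lo' (edge_index x) &
            hi (h x) = hi' (edge_index x)]].
Proof.
move=> nN mN good fit; pose n := #|sk_edge K|; pose m := #|sk_vertex K|.
have nN' : (n < N.+1)%N by rewrite ltnS.
have mN' : (m < N.+1)%N by rewrite ltnS.
pose nm : 'I_N.+1 * 'I_N.+1 := (Ordinal nN', Ordinal mN').
pose fib : code_fiber nm :=
  ([ffun x : 'I_n => (enum_rank (sk_src (enum_val x)),
                      enum_rank (sk_tgt (enum_val x)), sk_carrier (enum_val x))],
   [ffun y : 'I_m => sk_anchor (enum_val y)]).
pose c : code := existT _ nm fib.
pose h : sk_edge (skeleton_of_code c) -> sk_edge K := fun x : 'I_n => enum_val x.
pose h' : sk_vertex (skeleton_of_code c) -> sk_vertex K := fun y : 'I_m => enum_val y.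
have hb : bijective h by apply: enum_val_bij.
have hb' : bijective h' by apply: enum_val_bij.
have hs x : sk_src (h x) = h' (sk_src x) by rewrite /h /h' /= ffunE /= enum_rankK.
have ht x : sk_tgt (h x) = h' (sk_tgt x) by rewrite /h /h' /= ffunE /= enum_rankK.
have hc x : sk_carrier (h x) = sk_carrier x by rewrite /h /= ffunE.
have ha y : sk_anchor (h' y) = sk_anchor y by rewrite /h' /= ffunE.
pose ext (f : sk_edge K -> R) (j : nat) : R :=
  if insub j is Some x then f (enum_val (x : 'I_n)) else 0.
have extE f : ext f \o @edge_index c = f \o h.
  by apply/funext => x; rewrite /ext /= /edge_index valK.
exists c, (ext lo), (ext hi); rewrite !extE; split.
- exact: (relabel_good hb hb').
- exact: (relabel_fits hb).
- exact: (relabel_boundary hb hb').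
- exact: (relabel_length hb).
- exists h; split=> // x; have E f : f (h x) = ext f (edge_index x).
    by have /(congr1 (fun g => g x)) := extE f.
  by rewrite hc !E.
Qed.

End codes.

Section admissible.
Context {R : realType} (G : mgraph R) (N k : nat).

(** The combinatorial content of a partition whose ratios are at most [r].  The
    ratio condition is written without a quotient, so that it is closed
    also where the length vanishes. *)
Definition admissible (c : 'I_k -> code G N) (lo hi : 'I_k -> nat -> R) (r : R) : Prop :=
  [/\ forall i, sk_good (skeleton_of_code (c i)) /\
        exists x : sk_edge (skeleton_of_code (c i)), True,
      forall i, fits (lo i \o @edge_index _ _ _ (c i)) (hi i \o @edge_index _ _ _ (c i)),
      forall i j, i <> j -> forall (x : sk_edge (skeleton_of_code (c i)))
        (y : sk_edge (skeleton_of_code (c j))), sk_carrier x = sk_carrier y ->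
        hi i (edge_index x) <= lo j (edge_index y) \/
        hi j (edge_index y) <= lo i (edge_index x) &
      forall i, (sk_boundary (skeleton_of_code (c i)))%:R <=
        r * sk_length (lo i \o @edge_index _ _ _ (c i)) (hi i \o @edge_index _ _ _ (c i))].

(** If the length were 0, then so would be the boundary; a piece without boundary
    has no floating vertices, so its edges are full edges, of positive length. *)
Lemma sk_length_gt0 (K : skeleton G) (lo hi : sk_edge K -> R) (r : R) :
  fits lo hi -> (exists x : sk_edge K, True) ->
  (sk_boundary K)%:R <= r * sk_length lo hi -> 0 < sk_length lo hi.
Proof.
move=> [Fx Fs Ft _] [x _] br.
have l0 : 0 <= sk_length lo hi.
  by apply: sumr_ge0 => z _; have [_ + _] := Fx z; lra.
rewrite lt_neqAle l0 andbT eq_sym; apply/eqP => lz.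
have : (sk_boundary K <= 0)%N by rewrite -(ler_nat R) (le_trans br) // lz mulr0.
rewrite leqn0 sum_nat_eq0 => /forallP b0.
have anch (y : sk_vertex K) : sk_anchor y.
  by have := b0 y; rewrite /sk_eff_deg; case: (sk_anchor y).
have : hi x - lo x = 0.
  by move/eqP: lz; rewrite psumr_eq0 => [/allP/(_ x (mem_index_enum _))/eqP //|z _];
    have [_ + _] := Fx z; lra.
by rewrite (Fs x (anch _)) (Ft x (anch _)) subr0 => /eqP; rewrite gt_eqF // len_gt0.
Qed.

Lemma partition_of_admissible c lo hi r : 0 <= r -> admissible c lo hi r ->
  exists P : 'I_k -> subgraph G, is_partition P /\ Lambda_C P <= r.
Proof.
move=> r0 [cgood cfit cdisj cr].
have len0 i : 0 < sk_length (lo i \o @edge_index _ _ _ (c i))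
    (hi i \o @edge_index _ _ _ (c i)).
  by have [_ ?] := cgood i; apply: sk_length_gt0 (cr i).
exists (fun i => realize (cgood i).1 (cfit i)); split.
  apply/is_partitionP; split=> [i|i|i j ij f g fg].
  - exact: realize_connected.
  - exact: realize_has_edge.
  - have := cdisj i j ij (val f) (val g) fg.
    by rewrite /stop /= ![_ + (_ - _)]addrC !subrK.
apply: bigmax_le => // i _; rewrite realize_length ler_pdivrMr //.
exact: le_trans (realize_boundary _ _ _) (cr i).
Qed.

End admissible.

(** A reduced piece has at most 4 edges for each edge of the graph, and at most
    2 vertices for each of its edges; hence the bound 8. *)
Lemma admissible_of_partition (R : realType) (G : mgraph R) (k : nat)
    (P : 'I_k -> subgraph G) (r : R) : is_partition P -> Lambda_C P <= r ->
  exists (c : 'I_k -> code G (#|edge G| * 8)) lo hi, admissible c lo hi r.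
Proof.
move=> /is_partitionP[Pc Pe Pd] Pr.
have /choice[Q QP] i := exists_reduced (Pc i).
have Qe i : exists f : edge (Q i), True.
  have [_ _ lQ _ _] := QP i; have [f _] := Pe i; apply: contrapT => noe.
  have : 0 < total_length (Q i).
    rewrite lQ /total_length (bigD1 f) //= ltr_pwDl ?len_gt0 //.
    by apply: sumr_ge0 => g _; apply/ltW/len_gt0.
  by rewrite /total_length big1 ?ltxx // => g _; case: noe; exists g.
have Qd i j : i <> j -> nonoverlapping (Q i) (Q j).
  move=> ij; have [_ _ _ _ +] := QP i; apply; apply: nonoverlapping_sym.
  by have [_ _ _ _ +] := QP j; apply; apply: nonoverlapping_sym; apply: Pd.
have Qr i : (sk_boundary (skeleton_of (Q i)))%:R <= r * total_length (Q i).
  have [_ Qred lQ bQ _] := QP i; rewrite -skeleton_of_boundary // lQ.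
  apply: (le_trans bQ); have [f _] := Pe i.
  have l0 : 0 < total_length (P i).
    rewrite /total_length (bigD1 f) //= ltr_pwDl ?len_gt0 //.
    by apply: sumr_ge0 => g _; apply/ltW/len_gt0.
  rewrite -ler_pdivrMr //; apply: le_trans Pr.
  exact: (le_bigmax_cond _ (fun i => boundary_size (P i) / total_length (P i))).
have /choice[c] : forall i, exists t : code G (#|edge G| * 8) * (nat -> R) * (nat -> R),
    let: (ci, loi, hii) := t in
    [/\ sk_good (skeleton_of_code ci),
      fits (loi \o @edge_index _ _ _ ci) (hii \o @edge_index _ _ _ ci),
      sk_boundary (skeleton_of_code ci) = sk_boundary (skeleton_of (Q i)),
      sk_length (loi \o @edge_index _ _ _ ci) (hii \o @edge_index _ _ _ ci) =
        total_length (Q i) &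
      exists h : sk_edge (skeleton_of_code ci) -> edge (Q i), bijective h /\ forall x,
        [/\ carrier (h x) = sk_carrier x, start (h x) = loi (edge_index x) &
            stop (h x) = hii (edge_index x)]].
  move=> i; have [Qc Qred _ _ _] := QP i.
  have cE := reduced_card_edge Qred Qc.
  have [||||ci [loi [hii]]] := @exists_code R G (#|edge G| * 8) (skeleton_of (Q i))
    (@start _ _ _) (@stop _ _ _).
  - by apply: (leq_trans cE); rewrite leq_mul.
  - apply: (leq_trans (card_vertex _)).
    by rewrite (_ : 8 = 4 * 2)%N // mulnA leq_mul.
  - exact: skeleton_of_good.
  - exact: skeleton_of_fits.
  by rewrite skeleton_of_length => cP; exists (ci, loi, hii).
move=> cP; exists (fun i => (c i).1.1), (fun i => (c i).1.2), (fun i => (c i).2).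
split=> [i|i|i j ij x y xy|i].
- have := cP i; case: (c i) => [[ci loi] hii] [cg _ _ _ [h [hb _]]]; split=> //.
  by have [f _] := Qe i; have [g _ _] := hb; exists (g f).
- by have := cP i; case: (c i) => [[ci loi] hii] [].
- move: x y xy; have := cP i; have := cP j.
  case: (c i) => [[ci loi] hii]; case: (c j) => [[cj loj] hij] /=.
  move=> [_ _ _ _ [h [_ hP]]] [_ _ _ _ [h' [_ h'P]]] x y xy.
  have [cx <- <-] := h'P x; have [cy <- <-] := hP y.
  by apply: (Qd i j ij); rewrite cx cy.
- by have := cP i; case: (c i) => [[ci loi] hii] [_ _ /= -> -> _]; apply: Qr.
Qed.

(** * Limits of admissible positions *)

Lemma ultra_cvg (R : realType) (T : Type) (U : set_system T) (f : T -> R) (a b : R) :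
  UltraFilter U -> U [set n | a <= f n <= b] -> cvg (f @ U).
Proof.
move=> UU Uf; have PU : ProperFilter U by apply: ultra_proper.
have UI : U (f @^-1` `[a, b]) by apply: filterS Uf => n /=; rewrite in_itv.
have [p [_ pU]] := @segment_compact R a b (f @ U) _ UI.
apply/cvg_ex; exists p => A pA; have [//|UA] := in_ultra_setVsetC (f @^-1` A) UU.
by have [x [nAx Ax]] := pU (~` A) A UA pA.
Qed.

Lemma ultra_constant (T : Type) (F : finType) (U : set_system T) (f : T -> F) :
  UltraFilter U -> exists t, U [set n | f n = t].
Proof.
move=> UU; have PU : ProperFilter U by apply: ultra_proper.
apply: contrapT => /forallNP nU.
have /filter_forall : forall t, \forall n \near U, f n <> t.
  by move=> t; have [/nU|] := in_ultra_setVsetC [set n | f n = t] UU.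
by move=> /filter_ex[n /(_ (f n))].
Qed.

Lemma ultra_or (T : Type) (U : set_system T) (A B : set T) :
  UltraFilter U -> U (A `|` B) -> U A \/ U B.
Proof.
move=> UU UAB; have PU : ProperFilter U by apply: ultra_proper.
have [|UA] := in_ultra_setVsetC A UU; first by left.
by right; apply: filterS (filterI UAB UA) => n [[]].
Qed.

(** Compactness: there are finitely many codes, so along an ultrafilter the code
    is constant; the positions are bounded, so they converge; and the conditions
    are closed, where [ultra_or] decides the disjunctions. *)
Lemma admissible_limit (R : realType) (G : mgraph R) (N k : nat)
    (c : nat -> 'I_k -> code G N) (lo hi : nat -> 'I_k -> nat -> R)
    (r : nat -> R) (l : R) :
  (forall n, admissible (c n) (lo n) (hi n) (r n)) -> r n @[n --> \oo] --> l ->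
  exists c' lo' hi', @admissible R G N k c' lo' hi' l.
Proof.
move=> adm rl; have [U [UU sU]] := ultraFilterLemma (eventually_filter).
have PU : ProperFilter U by apply: ultra_proper.
have [c' Uc] := ultra_constant (fun n => [ffun i => c n i]) UU.
have {Uc}Uadm : \forall n \near U, admissible c' (lo n) (hi n) (r n).
  apply: filterS Uc => n /= cn; have := adm n.
  by congr (admissible _ _ _ _); apply/funext => i; rewrite -cn ffunE.
have rU : r @ U --> l by apply: cvg_trans rl; apply: cvg_app.
pose lo' i j := lim ((fun n => lo n i j) @ U).
pose hi' i j := lim ((fun n => hi n i j) @ U).
have lo_cvg i (x : sk_edge (skeleton_of_code (c' i))) :
    (fun n => lo n i (edge_index x)) @ U --> lo' i (edge_index x).
  apply: (@ultra_cvg _ _ _ _ 0 (len (sk_carrier x))) => //.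
  apply: filterS Uadm => n [_ cfit _ _] /=; have [/(_ x)[/= ? ? ?] _ _ _] := cfit i.
  by apply/andP; split; lra.
have hi_cvg i (x : sk_edge (skeleton_of_code (c' i))) :
    (fun n => hi n i (edge_index x)) @ U --> hi' i (edge_index x).
  apply: (@ultra_cvg _ _ _ _ 0 (len (sk_carrier x))) => //.
  apply: filterS Uadm => n [_ cfit _ _] /=; have [/(_ x)[/= ? ? ?] _ _ _] := cfit i.
  by apply/andP; split; lra.
have lim_or i j (x : sk_edge (skeleton_of_code (c' i)))
    (y : sk_edge (skeleton_of_code (c' j))) :
    (\forall n \near U, hi n i (edge_index x) <= lo n j (edge_index y) \/
      hi n j (edge_index y) <= lo n i (edge_index x)) ->
    hi' i (edge_index x) <= lo' j (edge_index y) \/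
      hi' j (edge_index y) <= lo' i (edge_index x).
  move=> /(ultra_or UU)[?|?]; [left|right].
    exact: ler_cvg_to (hi_cvg i x) (lo_cvg j y) _.
  exact: ler_cvg_to (hi_cvg j y) (lo_cvg i x) _.
exists c', lo', hi'; split=> [i|i|i j ij x y xy|i].
- by have [n [cgood _ _ _]] := filter_ex Uadm.
- have fitU : \forall n \near U, @fits _ _ (skeleton_of_code (c' i))
      (lo n i \o @edge_index _ _ _ (c' i)) (hi n i \o @edge_index _ _ _ (c' i)).
    by apply: filterS Uadm => n [_ + _ _]; apply.
  split=> [x|x xa|x xa|x y xy cxy] /=.
  + split.
    * apply: (cvgr_to_ge (lo_cvg i x)); apply: filterS fitU => n [/(_ x)[]//].
    * apply: (ler_cvg_to (lo_cvg i x) (hi_cvg i x)).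
      by apply: filterS fitU => n [/(_ x)[]//].
    * apply: (cvgr_to_le (hi_cvg i x)); apply: filterS fitU => n [/(_ x)[]//].
  + apply/eqP; rewrite eq_le; apply/andP; split.
      apply: (cvgr_to_le (lo_cvg i x)); apply: filterS fitU => n [_ Fs _ _].
      by have /= -> := Fs x xa.
    apply: (cvgr_to_ge (lo_cvg i x)); apply: filterS fitU => n [_ Fs _ _].
    by have /= -> := Fs x xa.
  + apply/eqP; rewrite eq_le; apply/andP; split.
      apply: (cvgr_to_le (hi_cvg i x)); apply: filterS fitU => n [_ _ Ft _].
      by have /= -> := Ft x xa.
    apply: (cvgr_to_ge (hi_cvg i x)); apply: filterS fitU => n [_ _ Ft _].
    by have /= -> := Ft x xa.
  + apply: lim_or; apply: filterS fitU => n [_ _ _ Fd].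
    exact: (Fd x y xy cxy).
- by apply: lim_or; apply: filterS Uadm => n [_ _ + _]; apply.
- have sum_cvg : (fun n => r n * sk_length (lo n i \o @edge_index _ _ _ (c' i))
      (hi n i \o @edge_index _ _ _ (c' i))) @ U -->
      l * sk_length (lo' i \o @edge_index _ _ _ (c' i)) (hi' i \o @edge_index _ _ _ (c' i)).
    apply: cvgM => //; rewrite /sk_length; apply: cvg_big => //; first exact: add_continuous.
    move=> x _.
    by apply: cvgB; [apply: hi_cvg|apply: lo_cvg].
  apply: (cvgr_to_ge sum_cvg); apply: filterS Uadm => n [_ _ _ +]; exact.
Qed.

(** * Existence *)

(** An edge is cut into [k] segments of equal length. *)
Lemma exists_partition (R : realType) (G : mgraph R) (k : nat) (e : edge G) :
  exists P : 'I_k -> subgraph G, is_partition P.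
Proof.
pose K := @Skeleton R G unit bool (fun=> false) (fun=> true) (fun=> e) (fun=> None).
pose pos (n : nat) : R := len e * (n%:R / k%:R).
have posS n : (0 < k)%N -> pos n < pos n.+1.
  move=> k0; rewrite /pos ltr_pM2l ?len_gt0 // ltr_pM2r ?invr_gt0 ?ltr0n //.
  by rewrite ltr_nat.
have pos_le m n : (m <= n)%N -> pos m <= pos n.
  move=> mn; rewrite /pos ler_pM2l ?len_gt0 // ler_wpM2r ?invr_ge0 ?ler0n //.
  by rewrite ler_nat.
have good : sk_good K.
  split=> // [S Scl [y0 Sy0] y|y _].
    by have /= := Scl tt; case: y0 Sy0; case: y => //; tauto.
  by rewrite /sk_degree (bigD1 (tt : sk_edge K)) //= big1 => [|[] //]; case: y.
have k0 (i : 'I_k) : (0 < k)%N := leq_ltn_trans (leq0n i) (ltn_ord i).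
have fit (i : 'I_k) : fits (K := K) (fun=> pos i) (fun=> pos i.+1).
  split=> // [x|[] [] //]; split.
  - by rewrite /pos mulr_ge0 ?divr_ge0 ?ler0n // ltW // len_gt0.
  - exact: pos_le.
  - have := pos_le i.+1 k (ltn_ord i); rewrite {2}/pos divff ?mulr1 //.
    by rewrite pnatr_eq0 -lt0n (k0 i).
have length_gt0 (i : 'I_k) : 0 < sk_length (K := K) (fun=> pos i) (fun=> pos i.+1).
  rewrite /sk_length (bigD1 (tt : sk_edge K)) //= big1 => [|[] //].
  by rewrite addr0 subr_gt0; apply: posS (k0 i).
exists (fun i => realize good (fit i)); apply/is_partitionP; split=> [i|i|i j ij f g _].
- exact: realize_connected.
- exact: realize_has_edge.
- rewrite /stop /= ![_ + (_ - _)]addrC !subrK.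
  have [lt_ij|lt_ji|/val_inj //] := ltngtP i j; [left|right]; exact: pos_le.
Qed.

Theorem theorem2p5 (R : realType) (G : mgraph R)
    (G_edge : (0 < #|edge G|)%N) (G_conn : mgraph_connected G)
    (k : nat) (k_ge2 : (2 <= k)%N) :
  exists P : 'I_k -> subgraph G,
    is_partition P /\ cheeger G k = Lambda_C P.
Proof.
have /card_gt0P[e _] := G_edge.
set A := [set x : R | exists P : 'I_k -> subgraph G, is_partition P /\ Lambda_C P = x].
have A0 : A !=set0 by have [P PP] := exists_partition k e; exists (Lambda_C P), P.
have A_ge0 x : A x -> 0 <= x.
  by move=> [P [_ <-]]; apply: bigmax_ge_id.
have Alb : has_lbound A by exists 0 => x /A_ge0.
have h0 : 0 <= cheeger G k by apply: lb_le_inf.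
have near_inf n : exists t : ('I_k -> code G (#|edge G| * 8)) *
    ('I_k -> nat -> R) * ('I_k -> nat -> R),
    admissible t.1.1 t.1.2 t.2 (cheeger G k + harmonic n).
  have [|x [P [PP Px]] xh] := @inf_adherent R A (harmonic n) _ (conj A0 Alb).
    exact: harmonic_gt0.
  have [|c [lo [hi adm]]] := admissible_of_partition PP (r := cheeger G k + harmonic n).
    by rewrite Px ltW.
  by exists (c, lo, hi).
have [t adm] := choice near_inf.
have [|c [lo [hi cadm]]] := admissible_limit adm (l := cheeger G k).
  rewrite -[X in _ --> X]addr0; apply: cvgD; [exact: cvg_cst|exact: cvg_harmonic].
have [P [PP Ph]] := partition_of_admissible h0 cadm.
exists P; split=> //; apply/eqP; rewrite eq_le Ph andbT.
by apply: ge_inf => //; exists P.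
Qed.
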